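(* Let $k$ be one of the following: (a) an algebraically closed field; (b) a pseudo-finite field; (c) the valuation ring of a nonarchimedean local field. Let $\mathcal{G}$ be a linear algebraic group over $k$ and let $G = \mathcal{G}(k)$ be its group of $k$-points. Then $G$ has the Honda property: for every $\gamma \in G$ such that $\gamma$ is a commutator in $G$ and every $\delta \in G$ such that $\langle \delta \rangle = \langle \gamma \rangle$, the element $\delta$ is also a commutator in $G$.
   Context: An element $\gamma$ of a group $G$ is a commutator if $\gamma = [\alpha,\beta]$ for some $\alpha,\beta\in G$, where $[\alpha,\beta]$ is the group commutator (e.g. $\alpha\beta\alpha^{-1}\beta^{-1}$; the set of commutators does not depend on the convention chosen). For $\gamma \in G$, $\langle\gamma\rangle$ denotes the cyclic subgroup generated by $\gamma$. A linear algebraic group over a commutative ring $k$ is a smooth closed subgroup scheme of $\mathrm{GL}_n$ (over $k$) for some $n\in\mathbb{N}$. A pseudo-finite field is an infinite field $k$ that is a model of the theory of finite fields: every first-order sentence in the language of rings that is true in every finite field is true in $k$. A nonarchimedean local field is either a finite extension of a $p$-adic field $\mathbb{Q}_p$ ($p$ a prime) or the field of Laurent series $\mathbb{F}_q(\!(T)\!)$ in an indeterminate $T$ for some prime power $q$. *)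

(* Defs.v *)
From HB Require Import structures.
From mathcomp Require Import all_boot all_order all_algebra all_field.
From mathcomp Require Import mpoly.

Set Implicit Arguments.
Unset Strict Implicit.
Unset Printing Implicit Defensive.

Import Order.TTheory GRing.Theory Num.Theory.
Local Open Scope ring_scope.

(** * Commutators and the Honda property *)

Section Honda.
Variable G : groupType.

Definition is_commutator (x : G) : Prop := exists a b : G, x = [~ a, b]%g.

Definition cyclic_subgroup (x y : G) : Prop :=
  exists n : nat, y = (x ^+ n)%g \/ y = (x ^- n)%g.

Definition honda_property : Prop :=
  forall x y : G, is_commutator x ->
    (forall z, cyclic_subgroup y z <-> cyclic_subgroup x z) ->
    is_commutator y.

End Honda.

(** * Linear algebraic groups *)

Section LinearAlgebraicGroup.
Variables (k : comUnitRingType) (n : nat).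

(* The coordinate ring of GL_n is k[x_ij, t] / (t det(x) - 1): the first n * n
   variables are the matrix entries (ordered as by [mxvec]), the last one is
   the inverse of the determinant. *)
Definition GL_coord (A : comUnitRingType) (g : 'M[A]_n) (i : 'I_(n * n + 1)) :
  A := (row_mx (mxvec g) ((\det g)^-1)%:M : 'rV_(n * n + 1)) 0 i.

(* The A-points, for a k-algebra A with structure map phi, of the closed
   subscheme of GL_n cut out by the equations in E. *)
Definition closed_points (E : seq {mpoly k[n * n + 1]})
    (A : comUnitRingType) (phi : {rmorphism k -> A}) : pred 'M[A]_n :=
  [pred g | (g \in unitmx) && all (fun p => mmap phi (GL_coord g) p == 0) E].

(* By Yoneda, a closed subscheme of GL_n is a closed subgroup scheme iff its
   A-points form a subgroup of GL_n(A) for every commutative k-algebra A. *)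
Definition is_subgroup_scheme (E : seq {mpoly k[n * n + 1]}) : Prop :=
  forall (A : comUnitRingType) (phi : {rmorphism k -> A}),
    [/\ 1%:M \in closed_points E phi,
        forall g h, g \in closed_points E phi -> h \in closed_points E phi ->
          g *m h \in closed_points E phi
      & forall g, g \in closed_points E phi -> invmx g \in closed_points E phi].

(* Infinitesimal lifting: points lift along every surjection pi : A -> B of
   k-algebras whose kernel has square zero. *)
Definition is_formally_smooth (E : seq {mpoly k[n * n + 1]}) : Prop :=
  forall (A B : comUnitRingType) (phi : {rmorphism k -> A})
      (pi : {rmorphism A -> B}),
    (forall b, exists a, pi a = b) ->
    (forall x y, pi x = 0 -> pi y = 0 -> x * y = 0) ->
    forall h, h \in closed_points E (pi \o phi) ->
      exists2 g, g \in closed_points E phi & map_mx pi g = h.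

(* Smooth means locally of finite presentation and formally smooth. A closed
   subscheme of GL_n over k is of finite presentation iff its ideal in the
   coordinate ring is finitely generated, so it is given here by a finite list
   of equations. *)
Record linear_algebraic_group := LinearAlgebraicGroup {
  lag_eqs :> seq {mpoly k[n * n + 1]};
  lag_subgroup : is_subgroup_scheme lag_eqs;
  lag_smooth : is_formally_smooth lag_eqs
}.

End LinearAlgebraicGroup.

Section RationalPoints.
Variables (k : comUnitRingType) (n : nat) (G : linear_algebraic_group k n).

Record rational_points := RationalPoint {
  rp_val :> 'M[k]_n;
  rp_valP : rp_val \in closed_points G (idfun : {rmorphism k -> k})
}.

HB.instance Definition _ := [isSub for rp_val].
HB.instance Definition _ := [Choice of rational_points by <:].

Definition rp_one : rational_points :=
  RationalPoint (let: And3 G1 _ _ := lag_subgroup G idfun in G1).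

Definition rp_mul (x y : rational_points) : rational_points :=
  RationalPoint (let: And3 _ GM _ := lag_subgroup G idfun in
                 GM _ _ (rp_valP x) (rp_valP y)).

Definition rp_inv (x : rational_points) : rational_points :=
  RationalPoint (let: And3 _ _ GV := lag_subgroup G idfun in
                 GV _ (rp_valP x)).

Lemma rp_unit (x : rational_points) : rp_val x \in unitmx.
Proof. by have /andP[] := rp_valP x. Qed.

Lemma rp_mulA : associative rp_mul.
Proof. by move=> x y z; apply: val_inj; rewrite /= mulmxA. Qed.

Lemma rp_mul1 : left_id rp_one rp_mul.
Proof. by move=> x; apply: val_inj; rewrite /= mul1mx. Qed.

Lemma rp_mulr1 : right_id rp_one rp_mul.
Proof. by move=> x; apply: val_inj; rewrite /= mulmx1. Qed.

Lemma rp_mulV : left_inverse rp_one rp_inv rp_mul.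
Proof. by move=> x; apply: val_inj; rewrite /= (mulVmx (rp_unit x)). Qed.

Lemma rp_mulrV : right_inverse rp_one rp_inv rp_mul.
Proof. by move=> x; apply: val_inj; rewrite /= (mulmxV (rp_unit x)). Qed.

HB.instance Definition _ := isGroup.Build rational_points
  rp_mulA rp_mul1 rp_mulr1 rp_mulV rp_mulrV.

End RationalPoints.

(** * Pseudo-finite fields *)

Section FirstOrder.
Variable R : unitRingType.

Fixpoint interp_term (t : GRing.term int) : GRing.term R :=
  match t with
  | GRing.Var i => @GRing.Var R i
  | GRing.Const m => GRing.Const m%:~R
  | GRing.NatConst m => @GRing.NatConst R m
  | GRing.Add t1 t2 => GRing.Add (interp_term t1) (interp_term t2)
  | GRing.Opp t1 => GRing.Opp (interp_term t1)
  | GRing.NatMul t1 m => GRing.NatMul (interp_term t1) m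
  | GRing.Mul t1 t2 => GRing.Mul (interp_term t1) (interp_term t2)
  | GRing.Inv t1 => GRing.Inv (interp_term t1)
  | GRing.Exp t1 m => GRing.Exp (interp_term t1) m
  end.

Fixpoint interp_formula (f : GRing.formula int) : GRing.formula R :=
  match f with
  | GRing.Bool b => @GRing.Bool R b
  | GRing.Equal t1 t2 => GRing.Equal (interp_term t1) (interp_term t2)
  | GRing.Unit t1 => GRing.Unit (interp_term t1)
  | GRing.And f1 f2 => GRing.And (interp_formula f1) (interp_formula f2)
  | GRing.Or f1 f2 => GRing.Or (interp_formula f1) (interp_formula f2)
  | GRing.Implies f1 f2 =>
      GRing.Implies (interp_formula f1) (interp_formula f2)
  | GRing.Not f1 => GRing.Not (interp_formula f1)
  | GRing.Exists i f1 => GRing.Exists i (interp_formula f1)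
  | GRing.Forall i f1 => GRing.Forall i (interp_formula f1)
  end.

(* R satisfies f when it satisfies the universal closure of f. *)
Definition models (f : GRing.formula int) : Prop :=
  forall e : seq R, GRing.holds e (interp_formula f).

End FirstOrder.

(* [GRing.rformula] excludes the symbols for inverses and units. The integer
   constants that remain are closed terms of the language of rings, so these
   formulas are exactly the first-order formulas in that language; sentences are
   given by the universal closures, see [models]. *)
Definition pseudo_finite (k : fieldType) : Prop :=
  (forall s : seq k, exists x, x \notin s) /\
  (forall f : GRing.formula int, GRing.rformula f ->
     (forall F : finFieldType, models F f) -> models k f).

(** * Nonarchimedean local fields *)

Section Valuation.
Variables (K : fieldType) (v : K -> int).

(* v is only meaningful on nonzero elements; v(0) is understood as +oo. *)
Definition val_ge (N : int) (x : K) : bool := (x == 0) || (N <= v x).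

Definition is_valuation : Prop :=
  (forall x y, x != 0 -> y != 0 -> v (x * y) = v x + v y) /\
  (forall N x y, val_ge N x -> val_ge N y -> val_ge N (x + y)).

Definition val_complete : Prop :=
  forall u : nat -> K,
    (forall N, exists m0, forall i j, (m0 <= i)%N -> (m0 <= j)%N ->
       val_ge N (u i - u j)) ->
    exists l, forall N, exists m0, forall i, (m0 <= i)%N -> val_ge N (u i - l).

End Valuation.

Definition padic_val (p : nat) (r : rat) : int :=
  (logn p `|numq r|%N)%:Z - (logn p `|denq r|%N)%:Z.

(* Q_p, with its valuation, is the completion of Q for the p-adic valuation. *)
Definition is_padic_field (p : nat) (K : fieldType) (v : K -> int) : Prop :=
  [/\ is_valuation v,
      val_complete v
    & exists iota : {rmorphism rat -> K},
        (forall r, r != 0 -> v (iota r) = padic_val p r) /\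
        (forall (x : K) (N : int), exists r, val_ge v N (x - iota r))].

(* [coef] identifies K with the field F((T)): an element x of K is the formal
   series \sum_i coef x i T^i, whose support is bounded below. *)
Definition is_laurent_series_field (F : fieldType) (K : fieldType)
    (coef : K -> int -> F) : Prop :=
  [/\ forall x y, coef x =1 coef y -> x = y,
      forall x, exists N : int, forall i, i < N -> coef x i = 0,
      forall a : int -> F, (exists N : int, forall i, i < N -> a i = 0) ->
        exists x, coef x =1 a,
      forall x y i, coef (x + y) i = coef x i + coef y i
    & forall (x y : K) (M N : int),
        (forall i, i < M -> coef x i = 0) ->
        (forall i, i < N -> coef y i = 0) ->
        (forall i, i < M + N -> coef (x * y) i = 0) /\
        (forall m : nat, coef (x * y) (M + N + m%:Z) =
           \sum_(i < m.+1) coef x (M + i%:Z) * coef y (N + (m - i)%:Z))].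

(* A nonarchimedean local field together with a discrete valuation defining its
   valuation ring. On a finite extension L of Q_p, this is a valuation which
   extends that of Q_p up to a ramification index e; on F((T)), it is the order
   of a series. *)
Inductive nonarch_local_field : forall K : fieldType, (K -> int) -> Prop :=
| PadicLocalField (p : nat) (Qp : fieldType) (vp : Qp -> int)
    (L : fieldExtType Qp) (v : L -> int) (e : nat) :
    prime p -> is_padic_field p vp -> is_valuation v -> (0 < e)%N ->
    (forall x : Qp, x != 0 -> v x%:A = vp x *+ e) ->
    nonarch_local_field v
| LaurentLocalField (F : finFieldType) (K : fieldType) (coef : K -> int -> F)
    (v : K -> int) :
    is_laurent_series_field coef ->
    (forall x, x != 0 ->
       coef x (v x) != 0 /\ forall i, i < v x -> coef x i = 0) ->
    nonarch_local_field v.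

Definition local_valuation_ring (O : comUnitRingType) : Prop :=
  exists (K : fieldType) (v : K -> int) (iota : {rmorphism O -> K}),
    [/\ nonarch_local_field v, injective iota
      & forall x, (exists a, iota a = x) <-> val_ge v 0 x].

Inductive honda_base_ring : comUnitRingType -> Prop :=
| BaseAlgClosed (k : fieldType) :
    GRing.closed_field_axiom k -> honda_base_ring k
| BasePseudoFinite (k : fieldType) : pseudo_finite k -> honda_base_ring k
| BaseValuationRing (k : comUnitRingType) :
    local_valuation_ring k -> honda_base_ring k.

(* Main.v *)
Require Import Defs.
From mathcomp Require Import all_boot all_order all_algebra all_field.
From mathcomp Require Import all_fingroup all_solvable all_character.
From mathcomp Require Import mpoly zify ring.
From Stdlib Require Import Classical ClassicalEpsilon.

(* An equation <delta> = <gamma> only says that delta and gamma are powers of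
   each other, so the point is to carry Honda's theorem from finite groups to
   G(k). In a finite group it follows from Frobenius's formula
   #{(a, b) | [a, b] = x} = \sum_chi |G| / chi(1) chi(x): the passage from x to
   another generator of <x> acts on the right-hand side by a field automorphism.

   Local fields: G(O) is compact, and its images modulo the ideals
   {v >= N} are finite groups, so the equation [c, d] = delta is solvable to
   every precision, and a limit of approximate solutions is a solution.

   Fields: for equations with fixed supports and fixed exponents, the statement
   "if the equations define a subgroup of GL_n(k), then this subgroup has the
   Honda property" is a first-order sentence in the coefficients. It holds in
   every finite field, hence in every pseudo-finite field. It also holds in the
   algebraic closure of F_p, because every finite set of matrices there is fixed
   by a power of the Frobenius and the fixed matrices form a finite group. By
   quantifier elimination its truth in an algebraically closed field depends
   only on which integers below some bound vanish in that field, so it holds in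
   every algebraically closed field. *)

Set Implicit Arguments.
Unset Strict Implicit.
Unset Printing Implicit Defensive.

Import Order.TTheory GRing.Theory Num.Theory.
Local Open Scope ring_scope.

(** * Honda's theorem for finite groups *)

Section FiniteHonda.
Variables (gT : finGroupType) (G : {group gT}).

Lemma irr_sum_conj (i : Iirr G) a c : a \in G -> c \in G ->
  \sum_(b in G) 'chi_i (a * c ^ b)%g = #|G|%:R * 'chi_i a * 'chi_i c / 'chi_i 1%g.
Proof.
move=> Ga Gc; set rG := 'Chi_i.
pose S := \sum_(b in G) rG (c ^ b)%g.
have /is_scalar_mxP[e De] : is_scalar_mx S.
  have irrG : mx_irreducible rG by apply: socle_irr.
  apply: mx_abs_irr_cent_scalar (groupC irrG) _ _; apply/centgmxP => x Gx.
  rewrite /S mulmx_suml mulmx_sumr [RHS](reindex_inj (mulIg x)) /=.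
  apply: eq_big => b; first by rewrite groupMr.
  move=> Gb; rewrite -!repr_mxM ?groupJ ?groupM //.
  by congr (rG _); rewrite conjgM conjgC.
have chiE x : x \in G -> 'chi_i x = \tr (rG x).
  by move=> Gx; rewrite -irrRepr cfunE Gx mulr1n.
have trS : #|G|%:R * 'chi_i c = e * 'chi_i 1%g.
  have := congr1 mxtrace De; rewrite /S mxtrace_scalar raddf_sum /=.
  rewrite (eq_bigr (fun=> 'chi_i c)) => [|b Gb]; last first.
    by rewrite -chiE ?groupJ // cfunJ.
  rewrite sumr_const mulr_natl => ->.
  by rewrite chiE // repr_mx1 mxtrace1 mulr_natr.
rewrite (mulrAC _ ('chi_i a)) trS (mulrAC _ _ ('chi_i a)) mulfK ?irr1_neq0 //.
transitivity (\tr (rG a *m S)); last first.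
  rewrite De mul_mx_scalar linearZ /= -chiE //.
rewrite /S mulmx_sumr raddf_sum /=; apply: eq_bigr => b Gb.
by rewrite -repr_mxM ?groupJ //; apply: chiE; rewrite groupM ?groupJ.
Qed.

Definition commg_count (x : gT) : nat :=
  #|[set ab in setX G G | [~ ab.1, ab.2]%g == x]|.

Lemma commg_countP x :
  reflect (exists a b, [/\ a \in G, b \in G & x = [~ a, b]%g])
          (commg_count x != 0)%N.
Proof.
rewrite cards_eq0; apply: (iffP (set0Pn _)) => [[[a b]]|[a [b [Ga Gb ->]]]].
  by rewrite !inE /= => /andP[/andP[Ga Gb] /eqP <-]; exists a, b.
by exists (a, b); rewrite !inE /= Ga Gb eqxx.
Qed.

(** Conjugating both members of a pair by [y] matches the pairs with commutator [x] and those with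
    commutator [x ^ y]; outside [G] there are no such pairs. *)
Lemma commg_count_class_fun :
  is_class_fun <<G>>%g [ffun x => (commg_count x)%:R : algC].
Proof.
apply: intro_class_fun => [x y Gx Gy | x notGx].
  rewrite /= genGid in Gx Gy; congr _%:R; rewrite /commg_count.
  pose J (ab : gT * gT) := (ab.1 ^ y, ab.2 ^ y)%g.
  have injJ : injective J.
    by move=> [a b] [a' b'] [/conjg_inj -> /conjg_inj ->].
  rewrite -[RHS](card_imset _ injJ); apply: eq_card => -[a b].
  apply/idP/imsetP => [|[[a' b'] H [-> ->]]].
    rewrite !inE /= => /andP[/andP[Ga Gb] /eqP Dx].
    exists (a ^ y^-1, b ^ y^-1)%g; last by rewrite /J /= !conjgKV.
    by rewrite !inE /= !groupJ ?groupV // -conjRg Dx conjgK eqxx.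
  move: H; rewrite !inE /= => /andP[/andP[Ga Gb] /eqP Dx].
  by rewrite !groupJ //= -conjRg Dx.
rewrite /= genGid in notGx; apply/eqP; rewrite pnatr_eq0.
apply: contraNT notGx => /commg_countP[a [b [Ga Gb ->]]].
by rewrite groupR.
Qed.

Definition commg_cfun : 'CF(G) := Cfun 0 commg_count_class_fun.

Lemma commg_cfunE x : commg_cfun x = (commg_count x)%:R.
Proof. by rewrite cfunE. Qed.

(** Frobenius's formula. The coefficient at ['chi_i] is a sum over pairs [(a, b)]; summing over [b]
    by [irr_sum_conj] leaves the norm of ['chi_i], which is 1. *)
Lemma commg_cfun_sum : commg_cfun = \sum_i (#|G|%:R / 'chi_i 1%g) *: 'chi[G]_i.
Proof.
rewrite [LHS]cfun_sum_cfdot; apply: eq_bigr => i _; congr (_ *: _).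
rewrite cfdotE.
have -> : \sum_(x in G) commg_cfun x * ('chi_i x)^* =
    \sum_(a in G) \sum_(b in G) ('chi_i [~ a, b]%g)^*.
  rewrite pair_big /= (partition_big (fun ab => [~ ab.1, ab.2]%g) (fun x => x \in G)) /=;
    last by move=> [a b] /andP[/= Ga Gb]; rewrite groupR.
  apply: eq_bigr => x Gx; rewrite commg_cfunE /commg_count.
  rewrite (eq_bigr (fun=> ('chi_i x)^*)); last by move=> ab /andP[_ /eqP->].
  rewrite sumr_const mulr_natl; congr (_ *+ _); apply: eq_card => -[a b].
  by rewrite !inE.
rewrite (eq_bigr (fun a => #|G|%:R / 'chi_i 1%g * ('chi_i a * ('chi_i a)^*))).
  rewrite -mulr_sumr mulrCA -cfdotE cfnorm_irr mulr1 //.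
move=> a Ga; rewrite -rmorph_sum /= (eq_bigr _ (fun b _ => congr1 _ (commgEl a b))).
rewrite irr_sum_conj ?groupV // irr_inv fmorph_div !rmorphM /= conjCK.
by rewrite irr1_degree !rmorph_nat -(mulrA #|G|%:R) mulrAC.
Qed.

(** On the cyclic group generated by [x], the character is a sum of linear characters with natural
    multiplicities, and their values at [x] are roots of unity of order dividing [#[x]]. *)
Lemma cfun_aut_exp (u : {rmorphism algC -> algC}) (chi : 'CF(G)) x k :
    chi \is a character -> x \in G ->
    (forall z, z ^+ #[x]%g = 1 -> u z = z ^+ k) ->
  u (chi x) = chi (x ^+ k)%g.
Proof.
move=> Nchi Gx uE; have sxG : <[x]>%g \subset G by rewrite cycle_subG.
have cX := cycle_abelian x.
rewrite -!(cfResE chi sxG) ?mem_cycle ?cycle_id //.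
have Nphi := cfRes_char <[x]>%G Nchi.
rewrite (cfun_sum_cfdot ('Res[<[x]>%G] chi)).
rewrite !sum_cfunE rmorph_sum; apply: eq_bigr => j _ /=.
rewrite !cfunE rmorphM /=.
have /natrP[m ->] := Cnat_cfdot_char_irr j Nphi.
rewrite rmorph_nat; congr (_ * _).
have linj : 'chi_j \is a linear_char by apply/char_abelianP.
by rewrite uE ?lin_charX ?cycle_id // -lin_charX ?cycle_id // expg_order lin_char1.
Qed.

Theorem finite_honda a b y : a \in G -> b \in G ->
    <[y]>%g = <[ [~ a, b] ]>%g ->
  exists c d, [/\ c \in G, d \in G & y = [~ c, d]%g].
Proof.
move=> Ga Gb; set x := [~ a, b]%g => Dxy.
have Gx : x \in G by rewrite groupR.
have /cycleP[k Dy] : y \in <[x]>%g by rewrite -Dxy cycle_id.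
have co_k : coprime k #[x]%g.
  by rewrite coprime_sym -generator_coprime -Dy /generator Dxy.
(* A Galois automorphism raising the [#[x]]-th roots of unity to the power [k]. It fixes the
   rational coefficients of Frobenius's formula, so it sends the count at [x] to the count at
   [y]. *)
have [u uE] := Qn_aut_exists co_k.
apply/commg_countP; have /commg_countP :
  exists a b, [/\ a \in G, b \in G & x = [~ a, b]%g].
  by exists a, b.
rewrite -!(@pnatr_eq0 algC) -!commg_cfunE.
suffices -> : commg_cfun y = u (commg_cfun x) by rewrite fmorph_eq0.
rewrite commg_cfun_sum !sum_cfunE rmorph_sum; apply: eq_bigr => i _ /=.
rewrite !cfunE rmorphM /= fmorph_div irr1_degree !rmorph_nat.
by rewrite (cfun_aut_exp (irr_char i) Gx uE) Dy.
Qed.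
End FiniteHonda.

(* [y = x ^ (-i)] when [s] is set, written without inverses so as to make sense
   in any ring. *)
Definition signed_power (M : pzRingType) (s : bool) (i : nat) (x y : M) : Prop :=
  if s then y * x ^+ i = 1 else y = x ^+ i.

(** Classical truth values, so that a finite set of permutations can be defined by an existential
    statement over an infinite group. *)
Definition asbool (P : Prop) : bool :=
  if excluded_middle_informative P then true else false.
Lemma asboolP P : reflect P (asbool P).
Proof. by rewrite /asbool; case: excluded_middle_informative => ?; constructor. Qed.

(** * Finite permutation quotients of a group of units in a ring *)

Section FiniteQuotient.
Variables (M : pzRingType) (V : pred M).
Hypothesis V1 : V 1.
Hypothesis VM : forall g h, V g -> V h -> V (g * h).
Hypothesis VV : forall g, V g -> exists2 h, V h & h * g = 1 /\ g * h = 1.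
Variables (e : rel M) (r : seq M).
Hypothesis e_sym : forall x y, e x y -> e y x.
Hypothesis e_trans : forall x y z, e x y -> e y z -> e x z.
Hypothesis eM : forall x y g, V g -> e x y -> e (x * g) (y * g).
Hypothesis r_cover : forall g, V g -> has (e g) r.

Let T := 'I_(size r).+1.
(** A class of [e] is coded by the index of the first element of [r] related to it. *)
Let f (g : M) : T := inord (find (e g) r).

Let f_eq g h : V g -> V h -> f g = f h <-> e g h.
Proof.
move=> Vg Vh; have [hg hh] := (r_cover Vg, r_cover Vh); split=> [Efgh | egh].
  have Efind : find (e g) r = find (e h) r.
    by move/(congr1 val): Efgh; rewrite /= !inordK ?ltnS ?find_size.
  apply: e_trans (nth_find 0 hg) _; apply: e_sym.
  by rewrite Efind; apply: nth_find.
rewrite /f; congr inord; apply: eq_find => x; apply/idP/idP; last exact: e_trans.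
exact: e_trans (e_sym egh).
Qed.

(** Right multiplication by [g] on the codes of classes meeting [V], by way of a chosen
    representative; all other codes are fixed, so that each [g] in [V] acts by a permutation of
    [T]. *)
Let act g t : T :=
  match excluded_middle_informative (exists x, V x /\ f x = t) with
  | left ex => f (proj1_sig (constructive_indefinite_description _ ex) * g)
  | right _ => t
  end.

Let actE g x : V g -> V x -> act g (f x) = f (x * g).
Proof.
move=> Vg Vx; rewrite /act; case: excluded_middle_informative; last by case; exists x.
move=> ex; case: constructive_indefinite_description => z [Vz /f_eq Ezx] /=.
by apply/f_eq; [apply: VM | apply: VM | apply/eM/Ezx].
Qed.

Let act_out g t : (forall x, V x -> f x <> t) -> act g t = t.
Proof.
move=> nt; rewrite /act; case: excluded_middle_informative => // -[x [Vx Dt]].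
by case: (nt x Vx).
Qed.

Let act_cases t : (exists2 x, V x & f x = t) \/ (forall x, V x -> f x <> t).
Proof.
case: (classic (exists2 x, V x & f x = t)) => [|nt]; [by left | right].
by move=> x Vx Dt; apply: nt; exists x.
Qed.

Let act_inj g : V g -> injective (act g).
Proof.
move=> Vg; have [h Vh [_ gh1]] := VV Vg.
have actK : cancel (act g) (act h).
  move=> t; have [[x Vx <-]|nt] := act_cases t; last by rewrite !act_out.
  by rewrite !actE ?VM // -mulrA gh1 mulr1.
exact: can_inj actK.
Qed.

Let rho g : {perm T} := odflt 1%g [pick p : {perm T} | [forall t, p t == act g t]].

Let rhoE g t : V g -> rho g t = act g t.
Proof.
move=> Vg; rewrite /rho; case: pickP => [p /forallP/(_ t)/eqP //|].
move/(_ (perm (@act_inj g Vg)))/forallP; case=> z.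
by rewrite permE.
Qed.

(** Permutations compose from left to right, so right multiplication gives a morphism and not an
    antimorphism. *)
Let rhoM g h : V g -> V h -> rho (g * h) = (rho g * rho h)%g.
Proof.
move=> Vg Vh; apply/permP=> t; rewrite permM !rhoE ?VM //.
have [[x Vx <-]|nt] := act_cases t; last by rewrite !act_out.
by rewrite !actE ?VM // mulrA.
Qed.

Let rho1 : rho 1 = 1%g.
Proof. by apply: (mulgI (rho 1)); rewrite mulg1 -rhoM ?mulr1. Qed.

Let rhoX g i : V g -> V (g ^+ i) /\ rho (g ^+ i) = (rho g ^+ i)%g.
Proof.
move=> Vg; elim: i => [|i [VX IH]]; first by rewrite expr0 expg0 rho1.
by rewrite exprS expgS rhoM ?IH //; split=> //; apply: VM.
Qed.

Let H := [set p | asbool (exists2 g, V g & p = rho g)].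

Let group_set_H : group_set H.
Proof.
apply/group_setP; split; first by rewrite inE; apply/asboolP; exists 1; rewrite ?rho1.
move=> p q; rewrite !inE => /asboolP[g Vg ->] /asboolP[h Vh ->].
by apply/asboolP; exists (g * h); rewrite ?rhoM //; apply: VM.
Qed.

Let rho_cycle s i x y : V x -> V y -> signed_power s i x y -> rho y \in <[rho x]>%g.
Proof.
move=> Vx Vy; have [VX rhoXx] := rhoX i Vx.
case: s => /= [yx1 | ->]; last by rewrite rhoXx mem_cycle.
have: (rho y * rho x ^+ i)%g = 1%g by rewrite -rhoXx -rhoM // yx1 rho1.
by move/(canRL (mulgK _)); rewrite mul1g => ->; rewrite groupV mem_cycle.
Qed.

(* The elements of V act by right multiplication on the finitely many classes
   of e that meet V; Honda's theorem is applied to the resulting group of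
   permutations. *)
Lemma honda_finite_quotient s t i j a b x y :
    V a -> V b -> V x -> V y -> b * a * x = a * b ->
    signed_power s i x y -> signed_power t j y x ->
  exists c d, [/\ V c, V d & e (d * c * y) (c * d)].
Proof.
move=> Va Vb Vx Vy Dx Dy Dx'.
have inH g : V g -> rho g \in Group group_set_H.
  by move=> Vg; rewrite inE; apply/asboolP; exists g.
have Exy : <[rho y]>%g = <[ [~ rho a, rho b] ]>%g.
  have <- : rho x = [~ rho a, rho b]%g.
    apply: (mulgI (rho b * rho a)%g); rewrite -!rhoM ?VM // Dx rhoM ?VM //.
    by rewrite commgEl conjgE rhoM // !mulgA mulgK mulgV mul1g.
  by apply/eqP; rewrite eqEsubset !cycle_subG (rho_cycle Vx Vy Dy) (rho_cycle Vy Vx Dx').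
have [p [q [Hp Hq Dyc]]] := finite_honda (inH _ Va) (inH _ Vb) Exy.
move: Hp Hq Dyc; rewrite !inE => /asboolP[c Vc ->] /asboolP[d Vd ->] Dyc.
exists c, d; split=> //.
have E : rho (d * c * y) = rho (c * d).
  rewrite !rhoM ?VM // Dyc.
  by rewrite commgEl conjgE !mulgA mulgK mulgV mul1g.
apply/f_eq; rewrite ?VM //.
(* Equal permutations agree on the class of 1, which they send to the classes of the two
   products. *)
have := congr1 (fun p : {perm T} => p (f 1)) E.
by rewrite !rhoE ?VM // !actE ?VM // !mul1r.
Qed.
End FiniteQuotient.

(** * Matrix groups modulo an ideal *)

Section MatrixSubgroup.
Variables (R : comUnitRingType) (n : nat).

Definition matrix_subgroup (V : pred 'M[R]_n) : Prop :=
  [/\ 1%:M \in V, forall g h, g \in V -> h \in V -> g *m h \in V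
    & forall g, g \in V -> g \in unitmx /\ invmx g \in V].

(** Signs and exponents are fixed so that this becomes a single first-order statement;
    [b * a * x = a * b] says that [x] is the commutator of [a] and [b] without using inverses. *)
Definition honda_at s t i j (V : pred 'M[R]_n) : Prop :=
  forall a b x y, a \in V -> b \in V -> x \in V -> y \in V ->
    b * a * x = a * b -> signed_power s i x y -> signed_power t j y x ->
  exists c d, [/\ c \in V, d \in V & d * c * y = c * d].

Definition matrix_honda (V : pred 'M[R]_n) : Prop := forall s t i j, honda_at s t i j V.

(** Entrywise congruence modulo the ideal [I] is compatible with right multiplication, and the
    matrices with entries in [r] represent all classes that meet [V], so [honda_finite_quotient]
    applies. *)
Lemma matrix_honda_mod (V : pred 'M[R]_n) (I : pred R) (r : seq R) s t i j a b x y :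
    matrix_subgroup V ->
    I 0 -> (forall u v, I u -> I v -> I (u - v)) -> (forall u v, I u -> I (u * v)) ->
    (forall g, g \in V -> forall i j, has (fun z => I (g i j - z)) r) ->
    a \in V -> b \in V -> x \in V -> y \in V -> b * a * x = a * b ->
    signed_power s i x y -> signed_power t j y x ->
  exists c d, [/\ c \in V, d \in V & forall i j, I ((d * c * y) i j - (c * d) i j)].
Proof.
move=> [V1 VM VV] I0 IB IM rP Va Vb Vx Vy Dx Dy Dx'.
have IN u : I u -> I (- u) by move=> Iu; rewrite -sub0r IB.
have ID u v : I u -> I v -> I (u + v) by move=> Iu Iv; rewrite -[v]opprK IB ?IN.
pose e := [rel g h : 'M[R]_n | [forall i, forall j, I (g i j - h i j)]].
have eP (g h : 'M[R]_n) : reflect (forall i j, I (g i j - h i j)) (e g h).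
  by apply: (iffP 'forall_forallP).
pose rM := [seq (\matrix_(i, j) val (f (i, j))) | f : {ffun 'I_n * 'I_n ->
  seq_sub r}] : seq 'M[R]_n.
have e_sym g h : e g h -> e h g.
  by move=> /eP gh; apply/eP=> k l; rewrite -opprB IN.
have e_trans g h w : e g h -> e h w -> e g w.
  by move=> /eP gh /eP hw; apply/eP=> k l; rewrite -(subrKA (h k l)) ID.
have eM g h w : w \in V -> e g h -> e (g * w) (h * w).
  move=> Vw /eP gh; apply/eP=> k l; rewrite !mxE -sumrB.
  by elim/big_ind: _ => // z _; rewrite -mulrBl; apply: IM.
have r_cover g : g \in V -> has (e g) rM.
  move=> Vg.
  have /fin_all_exists[f fP] : forall kl : 'I_n * 'I_n,
      exists z : seq_sub r, I (g kl.1 kl.2 - val z).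
    by move=> [k l]; have /hasP[z rz Iz] := rP g Vg k l; exists (SeqSub rz).
  apply/hasP; exists (\matrix_(i, j) val (finfun f (i, j))).
    by apply/imageP; exists (finfun f).
  by apply/eP=> k l; rewrite !mxE ffunE; apply: (fP (k, l)).
have VV' g : g \in V -> exists2 h, h \in V & h * g = 1 /\ g * h = 1.
  by move=> /VV[Ug VgV]; exists (invmx g); rewrite // -!mulmxE (mulVmx Ug) (mulmxV Ug).
have [c [d [Vc Vd /eP cdP]]] :=
  honda_finite_quotient V1 VM VV' e_sym e_trans eM r_cover Va Vb Vx Vy Dx Dy Dx'.
by exists c, d.
Qed.

(** This is the case of the zero ideal, where congruence is equality. *)
Lemma finite_matrix_honda (V : pred 'M[R]_n) (r : seq R) :
  matrix_subgroup V -> (forall g, g \in V -> forall i j, g i j \in r) -> matrix_honda V.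
Proof.
move=> VG rP s t i j a b x y Va Vb Vx Vy Dx Dy Dx'.
have [||||c [d [Vc Vd E]]] := @matrix_honda_mod V (pred1 0) r s t i j a b x y VG
    _ _ _ _ Va Vb Vx Vy Dx Dy Dx' => //=.
- by move=> u v /eqP-> /eqP->; rewrite subrr.
- by move=> u v /eqP->; rewrite mul0r.
- move=> g Vg k l; apply/hasP; exists (g k l); first exact: rP.
  by rewrite /= subrr.
exists c, d; split=> //; apply/matrixP=> k l.
by apply/eqP; rewrite -subr_eq0; apply: E.
Qed.
End MatrixSubgroup.

(** * Transfer between algebraically closed fields *)

Section TermMap.
Variables (A B : Type) (h : A -> B).

Fixpoint term_map (t : GRing.term A) : GRing.term B :=
  match t with
  | GRing.Var i => @GRing.Var B i
  | GRing.Const c => GRing.Const (h c)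
  | GRing.NatConst m => @GRing.NatConst B m
  | GRing.Add t1 t2 => GRing.Add (term_map t1) (term_map t2)
  | GRing.Opp t1 => GRing.Opp (term_map t1)
  | GRing.NatMul t1 m => GRing.NatMul (term_map t1) m
  | GRing.Mul t1 t2 => GRing.Mul (term_map t1) (term_map t2)
  | GRing.Inv t1 => GRing.Inv (term_map t1)
  | GRing.Exp t1 m => GRing.Exp (term_map t1) m
  end.

Fixpoint formula_map (f : GRing.formula A) : GRing.formula B :=
  match f with
  | GRing.Bool b => @GRing.Bool B b
  | GRing.Equal t1 t2 => GRing.Equal (term_map t1) (term_map t2)
  | GRing.Unit t1 => GRing.Unit (term_map t1)
  | GRing.And f1 f2 => GRing.And (formula_map f1) (formula_map f2)
  | GRing.Or f1 f2 => GRing.Or (formula_map f1) (formula_map f2)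
  | GRing.Implies f1 f2 => GRing.Implies (formula_map f1) (formula_map f2)
  | GRing.Not f1 => GRing.Not (formula_map f1)
  | GRing.Exists i f1 => GRing.Exists i (formula_map f1)
  | GRing.Forall i f1 => GRing.Forall i (formula_map f1)
  end.
End TermMap.

Lemma interp_termE (R : unitRingType) (t : GRing.term int) :
  interp_term R t = term_map intr t.
Proof. by elim: t => //= *; congruence. Qed.

Lemma interp_formulaE (R : unitRingType) (f : GRing.formula int) :
  interp_formula R f = formula_map intr f.
Proof.
by elim: f => //= *; rewrite ?interp_termE; congruence.
Qed.

Lemma formula_map_comp (A B C : Type) (g : B -> C) (h : A -> B) f :
  formula_map g (formula_map h f) = formula_map (g \o h) f.
Proof.
have tE t : term_map g (term_map h t) = term_map (g \o h) t.
  by elim: t => //= *; congruence.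
by elim: f => //= *; rewrite ?tE; congruence.
Qed.

Lemma eq_formula_map (A B : Type) (g h : A -> B) :
  g =1 h -> formula_map g =1 formula_map h.
Proof.
move=> gh f; have tE : term_map g =1 term_map h.
  by elim=> //= *; rewrite ?gh; congruence.
by elim: f => //= *; rewrite ?tE; congruence.
Qed.

Lemma term_map_rterm (A B : unitRingType) (h : A -> B) t :
  GRing.rterm (term_map h t) = GRing.rterm t.
Proof. by elim: t => //= t1 -> t2 ->. Qed.

Lemma formula_map_rformula (A B : unitRingType) (h : A -> B) f :
  GRing.rformula (formula_map h f) = GRing.rformula f.
Proof. by elim: f => //=; first [move=> t1 t2;
  rewrite !term_map_rterm | move=> f1 -> f2 ->]. Qed.

Lemma formula_map_qf (A B : unitRingType) (h : A -> B) f :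
  GRing.qf_form (formula_map h f) = GRing.qf_form f.
Proof. by elim: f => //= f1 -> f2 ->. Qed.

(* Quantifier elimination for algebraically closed fields manipulates the
   coefficients of formulas only formally, so it commutes with every map on
   them, whether or not this map is a ring morphism. *)
Section QEParametricity.
Import ClosedFieldQE.
Variables (A B : fieldType) (h : A -> B).

Notation tm := (term_map h).
Notation fm := (formula_map h).
Notation pm := (map (term_map h)).
Notation cps K T := ((T -> GRing.formula K) -> GRing.formula K).

(** The elimination procedure is written in continuation-passing style. Two computations are related
    if they turn continuations that correspond under [h] into formulas that correspond under [h]. *)
Definition cps_commute T1 T2 (r : T1 -> T2) (x : cps A T1) (x' : cps B T2) : Prop :=
  forall k k', (forall y, fm (k y) = k' (r y)) -> fm (x k) = x' k'.

Lemma cps_commute_ret T1 T2 (r : T1 -> T2) y : cps_commute r (ret y) (ret (r y)).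
Proof. by move=> k k' kk'; apply: kk'. Qed.

Lemma cps_commute_bind T1 T2 U1 U2 (r : T1 -> T2) (q : U1 -> U2) x x' f f' :
    cps_commute r x x' -> (forall y, cps_commute q (f y) (f' (r y))) ->
  cps_commute q (bind x f) (bind x' f').
Proof. by move=> xx' ff' k k' kk'; apply: xx' => y; apply: ff'. Qed.

Local Ltac cps_ret := let kk := fresh in move=> ? ? kk; apply: kk.

Lemma sizeT_map p : cps_commute id (sizeT p) (sizeT (pm p)).
Proof.
elim: p => [|c p IH] /=; first cps_ret.
apply: cps_commute_bind IH _ => -[|n] /=; last cps_ret.
by move=> k k' kk' /=; rewrite !kk'.
Qed.

Lemma isnull_map p : cps_commute id (isnull p) (isnull (pm p)).
Proof. by apply: cps_commute_bind (@sizeT_map p) _ => n; cps_ret. Qed.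

Lemma lt_sizeT_map p q : cps_commute id (lt_sizeT p q) (lt_sizeT (pm p) (pm q)).
Proof.
apply: cps_commute_bind (@sizeT_map p) _ => n.
by apply: cps_commute_bind (@sizeT_map q) _ => m; cps_ret.
Qed.

Lemma lead_coefT_map p : cps_commute tm (lead_coefT p) (lead_coefT (pm p)).
Proof.
elim: p => [|c p IH] /=; first cps_ret.
by apply: cps_commute_bind IH _ => l k k' kk' /=; rewrite !kk'.
Qed.

Lemma amulXnT_map a n : pm (amulXnT a n) = amulXnT (tm a) n.
Proof. by elim: n => //= n ->. Qed.

Lemma sumpT_map p q : pm (sumpT p q) = sumpT (pm p) (pm q).
Proof. by elim: p q => [|a p IH] [|b q] //=; rewrite IH. Qed.

Lemma mulpT_map p q : pm (mulpT p q) = mulpT (pm p) (pm q).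
Proof.
elim: p q => [|a p IH] q //=; rewrite sumpT_map /= IH -!map_comp.
by congr (sumpT _ _); apply: eq_map.
Qed.

Lemma opppT_map p : pm (opppT p) = opppT (pm p).
Proof. by rewrite /opppT -!map_comp; apply: eq_map. Qed.

Lemma natmulpT_map n p : pm (natmulpT n p) = natmulpT n (pm p).
Proof. by rewrite /natmulpT -!map_comp; apply: eq_map. Qed.

Let divm (x : nat * polyF A * polyF A) : nat * polyF B * polyF B :=
  (x.1.1, pm x.1.2, pm x.2).

Lemma redivp_rec_loopT_map q sq cq c qq r n :
  cps_commute divm (redivp_rec_loopT q sq cq c qq r n)
    (redivp_rec_loopT (pm q) sq (tm cq) c (pm qq) (pm r) n).
Proof.
elim: n c qq r => [|n IH] c qq r /=;
  (apply: cps_commute_bind (@sizeT_map r) _ => sr /=);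
  (case: ifP => _; first cps_ret);
  apply: cps_commute_bind (@lead_coefT_map r) _ => lr /=.
- have := @cps_commute_ret _ _ divm (c.+1,
  sumpT (mulpT qq [:: cq]) (amulXnT lr (sr - sq)),
    sumpT (mulpT r [:: cq]) (opppT (mulpT (amulXnT lr (sr - sq)) q))).
  by rewrite /divm /= !(sumpT_map, mulpT_map, opppT_map, amulXnT_map).
by have := IH c.+1 (sumpT (mulpT qq [:: cq]) (amulXnT lr (sr - sq)))
    (sumpT (mulpT r [:: cq]) (opppT (mulpT (amulXnT lr (sr - sq)) q)));
  rewrite !(sumpT_map, mulpT_map, opppT_map, amulXnT_map).
Qed.

Lemma redivpT_map p q : cps_commute divm (redivpT p q) (redivpT (pm p) (pm q)).
Proof.
apply: cps_commute_bind (@isnull_map q) _ => -[]; first cps_ret.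
apply: cps_commute_bind (@sizeT_map q) _ => sq.
apply: cps_commute_bind (@sizeT_map p) _ => sp.
apply: cps_commute_bind (@lead_coefT_map q) _ => lq.
exact: redivp_rec_loopT_map.
Qed.

Lemma rmodpT_map p q : cps_commute pm (rmodpT p q) (rmodpT (pm p) (pm q)).
Proof. by apply: cps_commute_bind (@redivpT_map p q) _ => d; cps_ret. Qed.

Lemma rdivpT_map p q : cps_commute pm (rdivpT p q) (rdivpT (pm p) (pm q)).
Proof. by apply: cps_commute_bind (@redivpT_map p q) _ => d; cps_ret. Qed.

Lemma rgcdp_loopT_map n p q :
  cps_commute pm (rgcdp_loopT n p q) (rgcdp_loopT n (pm p) (pm q)).
Proof.
elim: n p q => [|n IH] p q /=;
  (apply: cps_commute_bind (@rmodpT_map p q) _ => rr /=);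
  apply: cps_commute_bind (@isnull_map rr) _ => -[];
  by [cps_ret | exact: IH].
Qed.

Lemma rgcdpT_map p q : cps_commute pm (rgcdpT p q) (rgcdpT (pm p) (pm q)).
Proof.
(* [rgcdpT] puts the polynomial of larger size first; this is the body common to both orders. *)
have aux p1 q1 : cps_commute pm
    (bind (isnull p1) (fun b => if b then ret q1
       else bind (sizeT p1) (fun n => rgcdp_loopT n p1 q1)))
    (bind (isnull (pm p1)) (fun b => if b then ret (pm q1)
       else bind (sizeT (pm p1)) (fun n => rgcdp_loopT n (pm p1) (pm q1)))).
  apply: cps_commute_bind (@isnull_map p1) _ => -[]; first cps_ret.
  by apply: cps_commute_bind (@sizeT_map p1) _ => n; apply: rgcdp_loopT_map.
by apply: cps_commute_bind (@lt_sizeT_map p q) _ => -[]; apply: aux.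
Qed.

Lemma rgcdpTs_map ps : cps_commute pm (rgcdpTs ps) (rgcdpTs (map pm ps)).
Proof.
elim: ps => [|p ps IH] /=; first cps_ret.
by apply: cps_commute_bind IH _ => r; apply: rgcdpT_map.
Qed.

Lemma rgdcop_recT_map n q p :
  cps_commute pm (rgdcop_recT n q p) (rgdcop_recT n (pm q) (pm p)).
Proof.
elim: n q p => [|n IH] q p /=.
  by apply: cps_commute_bind (@isnull_map q) _ => b; cps_ret.
apply: cps_commute_bind (@rgcdpT_map p q) _ => g.
apply: cps_commute_bind (@sizeT_map g) _ => sg /=.
case: ifP => _; first cps_ret.
by apply: cps_commute_bind (@rdivpT_map p g) _ => r; apply: IH.
Qed.

Lemma ex_elim_seq_map ps q :
  fm (ex_elim_seq ps q) = ex_elim_seq (map pm ps) (pm q).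
Proof.
rewrite /ex_elim_seq.
suffices E : cps_commute id
    (bind (rgcdpTs ps) (fun g => bind (rgdcopT q g) (fun d => bind (sizeT d) (fun n =>
      ret (n != 1%N)))))
    (bind (rgcdpTs (map pm ps)) (fun g => bind (rgdcopT (pm q) g) (fun d =>
      bind (sizeT d) (fun n => ret (n != 1%N))))).
  by apply: E.
apply: cps_commute_bind (@rgcdpTs_map ps) _ => g.
have E : cps_commute pm (rgdcopT q g) (rgdcopT (pm q) (pm g)).
  by apply: cps_commute_bind (@sizeT_map g) _ => n; apply: rgdcop_recT_map.
apply: cps_commute_bind E _ => d.
by apply: cps_commute_bind (@sizeT_map d) _ => n; cps_ret.
Qed.

Lemma abstrX_map i t : pm (abstrX i t) = abstrX i (tm t).
Proof.
elim: t => //= [n|||||].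
- by case: ifP.
- by move=> t <- s <-; rewrite sumpT_map.
- by move=> t <-; rewrite opppT_map.
- by move=> t <- n; rewrite natmulpT_map.
- by move=> t <- s <-; rewrite mulpT_map.
by move=> t IH n; elim: n => //= n IHn; rewrite mulpT_map IH IHn.
Qed.

Let bcm (bc : seq (GRing.term A) * seq (GRing.term A)) := (pm bc.1, pm bc.2).

Lemma ex_elim_map i bc : fm (ex_elim i bc) = ex_elim i (bcm bc).
Proof.
rewrite /ex_elim ex_elim_seq_map abstrX_map -!map_comp /bcm /=; congr ex_elim_seq.
  by apply: eq_map => t /=; rewrite abstrX_map.
congr abstrX; rewrite unlock /=; elim: bc.2 => //= t ts <- //.
Qed.

Lemma and_dnf_map bcs1 bcs2 :
  map bcm (GRing.and_dnf bcs1 bcs2) = GRing.and_dnf (map bcm bcs1) (map bcm bcs2).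
Proof.
rewrite /GRing.and_dnf; elim: bcs1 => [|bc bcs IH]; first by rewrite !big_nil.
rewrite !big_cons map_cat IH -!map_comp; congr (_ ++ _).
by apply: eq_map => c; rewrite /bcm /= !map_cat.
Qed.

Lemma qf_to_dnf_map f b :
  map bcm (GRing.qf_to_dnf f b) = GRing.qf_to_dnf (fm f) b.
Proof.
elim: f b => //=.
- by move=> c b; case: ifP.
- by move=> t s [].
- by move=> t [].
- by move=> f1 IH1 f2 IH2 b; rewrite -IH1 -IH2; case: b; rewrite ?map_cat ?and_dnf_map.
- by move=> f1 IH1 f2 IH2 b; rewrite -IH1 -IH2; case: b; rewrite ?map_cat ?and_dnf_map.
- by move=> f1 IH1 f2 IH2 b; rewrite -IH1 -IH2; case: b; rewrite ?map_cat ?and_dnf_map.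
- by move=> _ _ _ [].
- by move=> _ _ _ [].
Qed.

Lemma quantifier_elim_map f :
  fm (GRing.quantifier_elim (@ex_elim A) f) = GRing.quantifier_elim (@ex_elim B) (fm f).
Proof.
have aux (F : GRing.formula A) n b :
    fm (foldr GRing.Or GRing.False (map (ex_elim n) (GRing.qf_to_dnf F b))) =
    foldr GRing.Or GRing.False (map (ex_elim n) (GRing.qf_to_dnf (fm F) b)).
  rewrite -qf_to_dnf_map; elim: (GRing.qf_to_dnf _ _) => //= bc bcs ->.
  by rewrite ex_elim_map.
elim: f => //=; do ?by move=> *; congruence.
Qed.
End QEParametricity.

(** Elimination requires coefficients in a field, so it is run over [rat]; the outcome has integer
    constants and serves all algebraically closed fields at once. *)
Definition elim_formula (f : GRing.formula int) : GRing.formula int :=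
  formula_map numq (GRing.quantifier_elim (@ClosedFieldQE.ex_elim rat)
    (interp_formula rat f)).

Lemma elim_formula_wf f : GRing.rformula f ->
  GRing.qf_form (elim_formula f) && GRing.rformula (elim_formula f).
Proof.
move=> rf; rewrite formula_map_qf formula_map_rformula.
apply: GRing.quantifier_elim_wf; first exact: ClosedFieldQE.wf_ex_elim.
by rewrite interp_formulaE formula_map_rformula.
Qed.

(* The integers [m] are recovered from their images in rat by [numq]. *)
Lemma elim_formulaP (K : fieldType) (Kclosed : GRing.closed_field_axiom K) f e :
    GRing.rformula f ->
  GRing.holds e (interp_formula K f) <->
    GRing.qf_eval e (interp_formula K (elim_formula f)).
Proof.
move=> rf.
have -> : interp_formula K (elim_formula f) =
    GRing.quantifier_elim (@ClosedFieldQE.ex_elim K) (interp_formula K f).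
  rewrite !interp_formulaE formula_map_comp quantifier_elim_map interp_formulaE.
  rewrite formula_map_comp; congr (GRing.quantifier_elim _ _).
  by apply: eq_formula_map => m /=; rewrite numq_int.
have rKf : GRing.rformula (interp_formula K f).
  by rewrite interp_formulaE formula_map_rformula.
by split=> [|] /(GRing.quantifier_elim_rformP (@ClosedFieldQE.wf_ex_elim K)
  (ClosedFieldQE.holds_ex_elim Kclosed) e rKf).
Qed.

Definition same_small_char (N : nat) (K L : fieldType) : Prop :=
  forall m, (m < N)%N -> (m%:R == 0 :> K) = (m%:R == 0 :> L).

(** In the empty environment variables take the value 0, so each atom tests whether one integer
    vanishes in the field. [N] exceeds the absolute values of all these integers. *)
Lemma qf_eval_small_char f : GRing.qf_form f -> GRing.rformula f ->
  exists N, forall K L : fieldType, same_small_char N K L ->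
    GRing.qf_eval [::] (interp_formula K f) = GRing.qf_eval [::] (interp_formula L f).
Proof.
have evalE (K : fieldType) (t : GRing.term int) : GRing.rterm t ->
    GRing.eval [::] (term_map (intr : int -> K) t) = (GRing.eval [::] t)%:~R.
  elim: t => //=.
  - by move=> n _; rewrite !nth_nil.
  - by move=> n _; rewrite natz.
  - by move=> t1 IH1 t2 IH2 /andP[/IH1-> /IH2->]; rewrite rmorphD.
  - by move=> t1 IH1 /IH1->; rewrite rmorphN.
  - by move=> t1 IH1 n /IH1->; rewrite rmorphMn.
  - by move=> t1 IH1 t2 IH2 /andP[/IH1-> /IH2->]; rewrite rmorphM.
  - by move=> t1 IH1 n /IH1->; rewrite rmorphXn.
have both N1 N2 (K L : fieldType) : same_small_char (maxn N1 N2) K L ->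
    same_small_char N1 K L /\ same_small_char N2 K L.
  by move=> KL; split=> m lt_m; apply: KL; rewrite leq_max lt_m ?orbT.
elim: f => //=.
- by move=> b _ _; exists 0%N.
- move=> t1 t2 _ /andP[r1 r2]; exists `|GRing.eval [::] t1 - GRing.eval [::] t2|.+1%N.
  have E (K : fieldType) : (GRing.eval [::] (interp_term K t1) == GRing.eval [::]
    (interp_term K t2)) =
      (`|GRing.eval [::] t1 - GRing.eval [::] t2|%N%:R == 0 :> K).
    rewrite !interp_termE !evalE // -subr_eq0 -rmorphB /=; move: (_ - _) => z.
    by case: z => m; rewrite ?NegzE ?rmorphN ?oppr_eq0 ?abszN.
  by move=> K L KL; rewrite !E KL.
- move=> f1 IH1 f2 IH2 /andP[q1 q2] /andP[r1 r2].
  have [[N1 E1] [N2 E2]] := (IH1 q1 r1, IH2 q2 r2).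
  by exists (maxn N1 N2) => K L /both[/E1-> /E2->].
- move=> f1 IH1 f2 IH2 /andP[q1 q2] /andP[r1 r2].
  have [[N1 E1] [N2 E2]] := (IH1 q1 r1, IH2 q2 r2).
  by exists (maxn N1 N2) => K L /both[/E1-> /E2->].
- move=> f1 IH1 f2 IH2 /andP[q1 q2] /andP[r1 r2].
  have [[N1 E1] [N2 E2]] := (IH1 q1 r1, IH2 q2 r2).
  by exists (maxn N1 N2) => K L /both[/E1-> /E2->].
by move=> f1 IH1 q1 r1; have [N1 E1] := IH1 q1 r1; exists N1 => K L /E1->.
Qed.

Lemma closed_field_transfer f : GRing.rformula f ->
  exists N, forall K L : fieldType,
    GRing.closed_field_axiom K -> GRing.closed_field_axiom L -> same_small_char N K L ->
    GRing.holds [::] (interp_formula K f) -> GRing.holds [::] (interp_formula L f).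
Proof.
move=> rf; have /andP[qg rg] := elim_formula_wf rf.
have [N gN] := qf_eval_small_char qg rg; exists N => K L clK clL KL.
by move/(elim_formulaP clK _ rf) => fK; apply/(elim_formulaP clL _ rf); rewrite -(gN K L).
Qed.

(** * The Honda property as a first-order sentence *)

(** One inverse-free term must serve all fields simultaneously. Closure properties of [term_fun] and
    [definable] then replace writing the Honda sentence by hand. *)
Definition term_fun (F : forall K : fieldType, seq K -> K) : Prop :=
  exists t : GRing.term int, GRing.rterm t /\
    forall (K : fieldType) (e : seq K), GRing.eval e (interp_term K t) = F K e.

Definition definable (P : forall K : fieldType, seq K -> Prop) : Prop :=
  exists f : GRing.formula int, GRing.rformula f /\
    forall (K : fieldType) (e : seq K), GRing.holds e (interp_formula K f) <-> P K e.

Lemma term_fun_var i : term_fun (fun K e => e`_i).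
Proof. by exists (@GRing.Var _ i). Qed.

Lemma term_fun_nat m : term_fun (fun K e => m%:R).
Proof. by exists (@GRing.NatConst _ m). Qed.

Lemma term_funD F G : term_fun F -> term_fun G -> term_fun (fun K e => F K e + G K e).
Proof.
move=> [t [rt tE]] [u [ru uE]]; exists (GRing.Add t u); split=> [|K e] /=.
  by rewrite rt ru.
by rewrite tE uE.
Qed.

Lemma term_funM F G : term_fun F -> term_fun G -> term_fun (fun K e => F K e * G K e).
Proof.
move=> [t [rt tE]] [u [ru uE]]; exists (GRing.Mul t u); split=> [|K e] /=.
  by rewrite rt ru.
by rewrite tE uE.
Qed.

Lemma term_funX F m : term_fun F -> term_fun (fun K e => F K e ^+ m).
Proof. by move=> [t [rt tE]]; exists (GRing.Exp t m); split=> // K e /=; rewrite tE. Qed.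

Lemma term_funN F : term_fun F -> term_fun (fun K e => - F K e).
Proof. by move=> [t [rt tE]]; exists (GRing.Opp t); split=> // K e /=; rewrite tE. Qed.

Lemma eq_term_fun F G : (forall K e, F K e = G K e) -> term_fun F -> term_fun G.
Proof. by move=> FG [t [rt tE]]; exists t; split=> // K e; rewrite tE FG. Qed.

Lemma term_fun_sum I (r : seq I) (F : I -> forall K : fieldType, seq K -> K) :
  (forall i, term_fun (F i)) -> term_fun (fun K e => \sum_(i <- r) F i K e).
Proof.
move=> FP; elim: r => [|i r IH].
  by apply: eq_term_fun (term_fun_nat 0) => K e; rewrite big_nil.
by apply: eq_term_fun (term_funD (FP i) IH) => K e; rewrite big_cons.
Qed.

Lemma term_fun_prod I (r : seq I) (F : I -> forall K : fieldType, seq K -> K) :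
  (forall i, term_fun (F i)) -> term_fun (fun K e => \prod_(i <- r) F i K e).
Proof.
move=> FP; elim: r => [|i r IH].
  by apply: eq_term_fun (term_fun_nat 1) => K e; rewrite big_nil.
by apply: eq_term_fun (term_funM (FP i) IH) => K e; rewrite big_cons.
Qed.

Lemma eq_definable P Q : (forall K e, P K e <-> Q K e) -> definable P -> definable Q.
Proof.
move=> PQ [f [rf fE]]; exists f; split=> // K e.
exact: iff_trans (fE K e) (PQ K e).
Qed.

Lemma definable_eq F G : term_fun F -> term_fun G -> definable (fun K e => F K e = G K e).
Proof.
move=> [t [rt tE]] [u [ru uE]]; exists (GRing.Equal t u); split=> [|K e] /=.
  by rewrite rt ru.
by rewrite tE uE.
Qed.

Lemma definable_true : definable (fun K e => True).
Proof. by exists (GRing.Bool true). Qed.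

Lemma definable_and P Q : definable P -> definable Q ->
  definable (fun K e => P K e /\ Q K e).
Proof.
move=> [f [rf fE]] [g [rg gE]]; exists (GRing.And f g); split=> [|K e] /=.
  by rewrite rf rg.
by have := (fE K e, gE K e); tauto.
Qed.

Lemma definable_imp P Q : definable P -> definable Q -> definable (fun K e => P K e ->
  Q K e).
Proof.
move=> [f [rf fE]] [g [rg gE]]; exists (GRing.Implies f g); split=> [|K e] /=.
  by rewrite rf rg.
by have := (fE K e, gE K e); tauto.
Qed.

Lemma definable_all (I : eqType) (r : seq I) (P : I -> forall K : fieldType, seq K ->
  Prop) :
  (forall i, definable (P i)) -> definable (fun K e => forall i, i \in r -> P i K e).
Proof.
move=> defP; elim: r => [|i r IH].
  by apply: eq_definable definable_true => K e; split.
apply: eq_definable (definable_and (defP i) IH) => K e; split.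
  by move=> [Pi Pr] j; rewrite inE => /predU1P[-> | /Pr].
by move=> Pir; split=> [|j rj]; apply: Pir; rewrite inE ?eqxx ?rj ?orbT.
Qed.

(** The effect on an environment of instantiating a string of quantifiers over consecutive variables
    starting at [s]. *)
Fixpoint set_block (K : nmodType) (s : nat) (w e : seq K) : seq K :=
  if w is x :: w' then set_block s.+1 w' (set_nth 0 e s x) else e.

Lemma nth_set_block (K : nmodType) s (w e : seq K) i :
  (set_block s w e)`_i = if (s <= i < s + size w)%N then w`_(i - s) else e`_i.
Proof.
elim: w s e => [|x w IH] s e /=; first by rewrite addn0 ltnNge andbN.
rewrite IH nth_set_nth /= addSnnS; case: (ltngtP i s) => //= [lt_si | ->].
- by case: ltnP => // _; rewrite -(subnSK lt_si).
by rewrite subnn -[X in (X < _)%N]addn0 ltn_add2l.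
Qed.

Lemma definable_forall_block s N P :
  definable P -> definable (fun K e => forall w, size w = N -> P K (set_block s w e)).
Proof.
move=> defP; elim: N s => [|N IH] s.
  apply: eq_definable defP => K e; split=> [Pe [] //|]; exact: (fun H => H [::] erefl).
have [f [rf fE]] := IH s.+1; exists (GRing.Forall s f); split=> // K e /=.
split=> [H [//|x w] [sz_w] | H x].
  by move/fE: (H x); apply.
by apply/fE => w sz_w; apply: (H (x :: w)); rewrite /= sz_w.
Qed.

Lemma definable_exists_block s N P :
  definable P -> definable (fun K e => exists2 w, size w = N & P K (set_block s w e)).
Proof.
move=> defP; elim: N s => [|N IH] s.
  apply: eq_definable defP => K e; split=> [Pe | [[] //]]; by exists [::].
have [f [rf fE]] := IH s.+1; exists (GRing.Exists s f); split=> // K e /=.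
split=> [[x /fE[w sz_w Pw]] | [[//|x w] [sz_w] Pw]].
  by exists (x :: w); rewrite //= sz_w.
by exists x; apply/fE; exists w.
Qed.

Section HondaSentence.
(* Each entry of [labels] is the support of one equation, and pairs every
   monomial with the variable that stands for its coefficient. The variables
   below C are reserved for the coefficients; they are followed by blocks of
   n * n + 1 variables, block k holding the coordinates [GL_coord] of the k-th
   matrix. *)
Variables (n : nat) (labels : seq (seq (nat * 'X_{1.. n * n + 1}))) (C : nat).
Hypothesis labels_lt : forall l cm, l \in labels -> cm \in l -> (cm.1 < C)%N.
Let M := (n * n + 1)%N.
Let bl k := (C + k * M)%N.

Definition gen_poly (K : fieldType) (e : seq K) (l : seq (nat * 'X_{1.. M})) :
  {mpoly K[M]} := \sum_(cm <- l) e`_cm.1 *: 'X_[cm.2].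

Definition gen_points (K : fieldType) (e : seq K) : pred 'M[K]_n :=
  closed_points [seq gen_poly e l | l <- labels] (idfun : {rmorphism K -> K}).

Let env_coord k (K : fieldType) (e : seq K) (i : 'I_M) := e`_(bl k + i).

Let env_mx (k : nat) (K : fieldType) (e : seq K) : 'M[K]_n :=
  \matrix_(i, j) env_coord k e (lshift 1 (mxvec_index i j)).

Let gen_value (K : fieldType) (e : seq K) (l : seq (nat * 'X_{1.. M})) (h : 'I_M ->
  K) : K :=
  \sum_(cm <- l) e`_cm.1 * mmap1 h cm.2.

Let gen_valueE (K : fieldType) (e : seq K) l (h : 'I_M -> K) :
  mmap (idfun : {rmorphism K -> K}) h (gen_poly e l) = gen_value e l h.
Proof.
rewrite /gen_poly raddf_sum; apply: eq_bigr => cm _ /=.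
by rewrite mmapZ mmapX.
Qed.

(** The last variable of a block is tied to the determinant by a polynomial equation, which
    expresses invertibility without an inverse symbol. *)
Let env_points (k : nat) (K : fieldType) (e : seq K) : Prop :=
  \det (env_mx k e) * env_coord k e (rshift (n * n) ord0) = 1 /\
  forall l, l \in labels -> gen_value e l (env_coord k e) = 0.

Let term_fun_env_mx k i j : term_fun (fun K e => env_mx k e i j).
Proof.
by apply: eq_term_fun (term_fun_var (bl k + lshift 1 (mxvec_index i j))) => K e;
  rewrite mxE.
Qed.

Let definable_env_points k : definable (fun K e => env_points k e).
Proof.
apply: definable_and.
  apply: definable_eq; last exact: term_fun_nat 1.
  apply: term_funM; last exact: term_fun_var.
  (* The determinant unfolds to its Leibniz expansion, a sum of signed products. *)
  apply: term_fun_sum => s; apply: term_funM.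
    by apply: term_funX; apply: term_funN; apply: term_fun_nat 1.
  by apply: term_fun_prod => i; apply: term_fun_env_mx.
apply: definable_all => l; apply: definable_eq; last exact: term_fun_nat 0.
apply: term_fun_sum => cm; apply: term_funM; first exact: term_fun_var.
by apply: term_fun_prod => i; apply: term_funX; apply: term_fun_var.
Qed.

Let coords (K : fieldType) (g : 'M[K]_n) : seq K := [seq GL_coord g i | i <- enum 'I_M].

Let size_coords (K : fieldType) (g : 'M[K]_n) : size (coords g) = M.
Proof. by rewrite size_map size_enum_ord. Qed.

Let nth_coords (K : fieldType) (g : 'M[K]_n) (i : 'I_M) : (coords g)`_i = GL_coord g i.
Proof. by rewrite (nth_map i) ?size_enum_ord ?nth_ord_enum. Qed.

Let set_mx k (K : fieldType) (g : 'M[K]_n) (e : seq K) := set_block (bl k) (coords g) e.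

Let env_coord_set k k' (K : fieldType) w (e : seq K) (i : 'I_M) : size w = M ->
  env_coord k (set_block (bl k') w e) i = if k == k' then w`_i else env_coord k e i.
Proof.
move=> sz_w; rewrite /env_coord nth_set_block sz_w.
case: (ltngtP k k') => [lt_kk'|lt_k'k|->].
- rewrite ifF //; apply/negbTE; rewrite negb_and -ltnNge; apply/orP; left.
  rewrite /bl -addnA ltn_add2l (leq_trans (n := k.+1 * M)) ?leq_mul2r ?lt_kk' ?orbT //.
  by rewrite mulSn addnC ltn_add2r.
- rewrite ifF //; apply/negbTE; rewrite negb_and -leqNgt; apply/orP; right.
  rewrite /bl -!addnA leq_add2l (leq_trans (n := k * M)) ?leq_addr //.
  by rewrite -mulSnr leq_mul2r lt_k'k orbT.
by rewrite leq_addr ltn_add2l ltn_ord addKn.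
Qed.

Let env_mx_set k k' (K : fieldType) g (e : seq K) :
  env_mx k (set_mx k' g e) = if k == k' then g else env_mx k e.
Proof.
apply/matrixP=> i j; rewrite mxE env_coord_set ?size_coords //.
rewrite nth_coords; case: ifP => _; last by rewrite mxE.
by rewrite /GL_coord row_mxEl mxvecE.
Qed.

(** Coefficient variables lie below [C] and blocks do not, so assigning a matrix leaves the
    equations unchanged. *)
Let gen_poly_set k (K : fieldType) w (e : seq K) l : l \in labels ->
  gen_poly (set_block (bl k) w e) l = gen_poly e l.
Proof.
move=> lin; apply: eq_big_seq => cm /(labels_lt lin) lt_cm.
by rewrite nth_set_block leqNgt (leq_trans lt_cm) ?leq_addr.
Qed.

Let gen_points_set k (K : fieldType) w (e : seq K) :
  gen_points (set_block (bl k) w e) = gen_points e.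
Proof.
rewrite /gen_points.
have -> // : map (gen_poly (set_block (bl k) w e)) labels = map (gen_poly e) labels.
by apply/eq_in_map => l lin; apply: gen_poly_set.
Qed.

(** The determinant equation forces the last coordinate of a block, so quantifying over blocks
    amounts to quantifying over points of the group. *)
Let env_pointsP k (K : fieldType) w (e : seq K) : size w = M ->
  env_points k (set_block (bl k) w e) <-> exists2 g, g \in gen_points e & w = coords g.
Proof.
move=> sz_w; set e' := set_block _ _ _.
have wE i : env_coord k e' i = w`_i by rewrite env_coord_set // eqxx.
have valE l g : l \in labels -> (forall i, env_coord k e' i = GL_coord g i) ->
    gen_value e' l (env_coord k e') =
    mmap (idfun : {rmorphism K -> K}) (GL_coord g) (gen_poly e l).
  move=> lin E; rewrite -(gen_poly_set k w) // gen_valueE.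
  by apply: eq_bigr => cm _; congr (_ * _); apply: mmap1_eq.
split=> [[det1 V0] | [g gV Dw]].
  have det_nz : \det (env_mx k e') != 0.
    by apply/eqP=> det0; move/eqP: det1; rewrite det0 mul0r eq_sym oner_eq0.
  have E i : env_coord k e' i = GL_coord (env_mx k e') i.
    rewrite /GL_coord; case: (split_ordP i) => i' ->.
      rewrite row_mxEl; case/mxvec_indexP: i' => i1 i2.
      by rewrite mxvecE mxE.
    by rewrite row_mxEr ord1 mxE eqxx mulr1n; apply: (mulfI det_nz); rewrite det1 mulfV.
  exists (env_mx k e').
    rewrite inE /=; apply/andP; split; first by rewrite unitmxE unitfE.
    by apply/allP=> _ /mapP[l lin ->]; rewrite -valE // V0.
  apply: (@eq_from_nth _ 0); rewrite ?size_coords // sz_w => i lt_i.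
  by rewrite (nth_coords _ (Ordinal lt_i)) -E wE.
have E i : env_coord k e' i = GL_coord g i by rewrite wE Dw nth_coords.
have Eg : env_mx k e' = g by rewrite /e' Dw env_mx_set eqxx.
case/andP: gV => Ug /allP V0; split.
  rewrite Eg E /GL_coord row_mxEr mxE eqxx mulr1n mulfV //.
  by rewrite -unitfE -unitmxE.
by move=> l lin; rewrite (valE _ g) //; apply/eqP/V0/map_f.
Qed.

Let definable_forall k P : definable P ->
  definable (fun K e => forall g, g \in gen_points e -> P K (set_mx k g e)).
Proof.
move=> defP.
apply: eq_definable (definable_forall_block (bl k)
  M (definable_imp (definable_env_points k) defP)).
move=> K e; split=> [H g gV | H w sz_w /(env_pointsP _ _ sz_w)[g gV ->]]; last exact: H.
by apply: H; rewrite ?size_coords //; apply/env_pointsP; rewrite ?size_coords //;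
  exists g.
Qed.

Let definable_exists k P : definable P ->
  definable (fun K e => exists2 g, g \in gen_points e & P K (set_mx k g e)).
Proof.
move=> defP.
apply: eq_definable (definable_exists_block (bl k)
  M (definable_and (definable_env_points k) defP)).
move=> K e; split=> [[w sz_w [/(env_pointsP _ _ sz_w)[g gV ->] Pg]] | [g gV Pg]];
  first by exists g.
exists (coords g); rewrite ?size_coords //; split=> //.
by apply/env_pointsP; rewrite ?size_coords //; exists g.
Qed.

Let term_mx (F : forall K : fieldType, seq K -> 'M[K]_n) :=
  forall i j, term_fun (fun K e => F K e i j).

Let term_mxM F G : term_mx F -> term_mx G -> term_mx (fun K e => F K e * G K e).
Proof.
move=> tF tG i j; apply: (@eq_term_fun (fun K e => \sum_k F K e i k * G K e k j)).
  by move=> K e; rewrite mxE.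
by apply: term_fun_sum => k; apply: term_funM.
Qed.

Let term_mx1 : term_mx (fun K e => 1).
Proof.
move=> i j; apply: eq_term_fun (term_fun_nat (i == j)) => K e.
by rewrite mxE.
Qed.

Let term_mxX F m : term_mx F -> term_mx (fun K e => F K e ^+ m).
Proof.
move=> tF; elim: m => [|m IH] i j.
  by apply: eq_term_fun (term_mx1 i j) => K e; rewrite expr0.
by apply: eq_term_fun (term_mxM tF IH i j) => K e; rewrite exprS.
Qed.

Let definable_mx_eq F G : term_mx F -> term_mx G -> definable (fun K e => F K e = G K e).
Proof.
move=> tF tG.
have defE : definable (fun K e => forall i, i \in enum 'I_n ->
  forall j, j \in enum 'I_n -> F K e i j = G K e i j).
  by apply: definable_all => i; apply: definable_all => j; apply: definable_eq.
apply: eq_definable defE => K e; split=> [E | -> //].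
by apply/matrixP=> i j; apply: E; rewrite mem_enum.
Qed.

Let definable_signed_power F G s i : term_mx F -> term_mx G ->
  definable (fun K e => signed_power s i (F K e) (G K e)).
Proof.
move=> tF tG; case: s; apply: definable_mx_eq => //; last exact: term_mxX.
by apply: term_mxM => //; apply: term_mxX.
Qed.

Let term_env_mx k : term_mx (fun K e => env_mx k e).
Proof. by move=> i j; apply: term_fun_env_mx. Qed.

(** A form of [matrix_subgroup] that is visibly first-order: inverses are given by the existence of
    a left inverse. *)
Let axioms (K : fieldType) (e : seq K) : Prop :=
  [/\ 1%:M \in gen_points e,
    forall g, g \in gen_points e -> forall h, h \in gen_points e ->
      g *m h \in gen_points e
  & forall g, g \in gen_points e -> exists2 h, h \in gen_points e & h *m g = 1%:M].

Let axiomsP (K : fieldType) (e : seq K) : axioms e <-> matrix_subgroup (gen_points e).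
Proof.
have unitV g : g \in gen_points e -> g \in unitmx by case/andP.
split=> -[V1 VM VV]; split=> //.
- by move=> g h Vg; apply: VM.
- move=> g Vg; have Ug := unitV g Vg; split=> //; have [h Vh hg1] := VV g Vg.
  by rewrite -[invmx g]mul1mx -hg1 mulmxK.
- by move=> g Vg h; apply: VM.
move=> g Vg; have [Ug VgV] := VV g Vg.
by exists (invmx g); rewrite ?mulVmx.
Qed.

Let definable_axioms : definable (fun K e => axioms e).
Proof.
have def1 := @definable_exists 0 (fun K e => env_mx 0 e = 1)
  (definable_mx_eq (term_env_mx 0) term_mx1).
have defM := definable_forall 0 (definable_forall 1
  (@definable_exists 2 (fun K e => env_mx 2 e = env_mx 0 e * env_mx 1 e)
    (definable_mx_eq (term_env_mx 2) (term_mxM (term_env_mx 0) (term_env_mx 1))))).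
have defV := definable_forall 0
  (@definable_exists 1 (fun K e => env_mx 1 e * env_mx 0 e = 1)
    (definable_mx_eq (term_mxM (term_env_mx 1) (term_env_mx 0)) term_mx1)).
apply: eq_definable (definable_and def1 (definable_and defM defV)) => K e.
split=> [[V1 [VM VV]] | [V1 VM VV]].
  split=> [|g Vg h Vh|g Vg].
  - by case: V1 => g Vg /=; rewrite env_mx_set /= => E; rewrite -[1%:M]/(1 : 'M_n) -E.
  - have := VM g Vg h; rewrite !gen_points_set => /(_ Vh)[w Vw].
    by rewrite !env_mx_set /= mulmxE => <-.
  have [h] := VV g Vg; rewrite gen_points_set !env_mx_set /= => Vh hg1.
  by exists h.
split; first by exists 1%:M; rewrite ?env_mx_set.
split=> [g Vg h | g Vg].
  rewrite !gen_points_set => Vh; exists (g *m h); first exact: VM.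
  by rewrite !env_mx_set.
by have [h Vh hg1] := VV g Vg; exists h; rewrite ?gen_points_set ?env_mx_set.
Qed.

Let definable_honda s t i j : definable (fun K e => honda_at s t i j (gen_points e)).
Proof.
have term_mxM3 k l m : term_mx (fun K e => env_mx k e * env_mx l e * env_mx m e).
  by do 2?[apply: term_mxM; last exact: term_env_mx]; apply: term_env_mx.
(* Blocks 0 to 3 hold [a], [b], [x], [y]; blocks 4 and 5 hold [c] and [d]. *)
have defC := definable_exists 4 (@definable_exists 5
  (fun K e => env_mx 5 e * env_mx 4 e * env_mx 3 e = env_mx 4 e * env_mx 5 e)
  (definable_mx_eq (term_mxM3 5 4 3)%N (term_mxM (term_env_mx 4) (term_env_mx 5)))).
have defX := @definable_mx_eq (fun K e => env_mx 1 e * env_mx 0 e * env_mx 2 e)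
  (fun K e => env_mx 0 e * env_mx 1 e)
  (term_mxM3 1 0 2)%N (term_mxM (term_env_mx 0) (term_env_mx 1)).
have defP1 := definable_signed_power s i (term_env_mx 2) (term_env_mx 3).
have defP2 := definable_signed_power t j (term_env_mx 3) (term_env_mx 2).
have defH := definable_forall 0 (definable_forall 1 (definable_forall 2
  (definable_forall 3
  (definable_imp defX (definable_imp defP1 (definable_imp defP2 defC)))))).
apply: eq_definable defH => K e; rewrite /honda_at.
split=> [H a b x y Va Vb Vx Vy Dx Dy Dx' | H a Va b + x + y].
  have := H a Va b _ x _ y; rewrite !gen_points_set.
  move=> /(_ Vb Vx Vy) /=; rewrite !env_mx_set /=.
  move=> /(_ Dx Dy Dx')[c]; rewrite !gen_points_set => Vc [d].
  by rewrite !env_mx_set /= => Vd Dc; exists c, d.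
rewrite !gen_points_set /= !env_mx_set /= => Vb Vx Vy Dx Dy Dx'.
have [c [d [Vc Vd Dc]]] := H a b x y Va Vb Vx Vy Dx Dy Dx'.
exists c; rewrite ?gen_points_set //.
by exists d; rewrite ?gen_points_set ?env_mx_set.
Qed.

(** The coefficients are quantified universally as well, so the formula depends only on the supports
    of the equations and makes sense in every field. *)
Lemma honda_sentence s t i j : exists f : GRing.formula int,
  [/\ GRing.rformula f,
    forall K : fieldType,
      (forall V : pred 'M[K]_n, matrix_subgroup V -> honda_at s t i j V) ->
      forall e : seq K, GRing.holds e (interp_formula K f)
  & forall (K : fieldType) (e : seq K), size e = C ->
      GRing.holds [::] (interp_formula K f) ->
      matrix_subgroup (gen_points e) -> honda_at s t i j (gen_points e)].
Proof.
have [f [rf fE]] := definable_forall_block 0 C (definable_imp definable_axioms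
  (definable_honda s t i j)).
exists f; split=> // [K H e | K e sz_e].
  by apply/fE => w _ /axiomsP; apply: H.
move=> /fE/(_ e sz_e) H /axiomsP.
have Eg : gen_points (set_block 0 e [::]) = gen_points e.
  rewrite /gen_points.
  have -> // : map (gen_poly (set_block 0 e [::])) labels = map (gen_poly e) labels.
  apply/eq_in_map => l lin; apply: eq_big_seq => cm /(labels_lt lin) lt_cm.
  by rewrite nth_set_block /= add0n sz_e lt_cm subn0.
by rewrite /axioms -Eg.
Qed.
End HondaSentence.

(* Equal coefficients share a variable. *)
Lemma gen_polys (n : nat) (K : fieldType) (E : seq {mpoly K[n * n + 1]}) :
  exists labels : seq (seq (nat * 'X_{1.. n * n + 1})), exists2 e : seq K,
    forall l cm, l \in labels -> cm \in l -> (cm.1 < size e)%N &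
    [seq gen_poly e l | l <- labels] = E.
Proof.
pose U := flatten [seq [seq p@_m | m <- msupp p] | p <- E].
have U_in p m : p \in E -> m \in msupp p -> p@_m \in U.
  move=> pE mp; apply/flatten_mapP; exists p => //; exact: map_f.
exists [seq [seq (index p@_m U, m) | m <- msupp p] | p <- E]; exists U.
  by move=> _ _ /mapP[p pE ->] /mapP[m mp ->]; rewrite index_mem U_in.
rewrite -map_comp -[RHS]map_id; apply/eq_in_map => p pE /=.
rewrite /gen_poly big_map [RHS]mpolyE; apply: eq_big_seq => m mp.
by rewrite nth_index ?U_in.
Qed.

(** * Fields *)

Lemma finite_field_honda (F : finFieldType) n (V : pred 'M[F]_n) :
  matrix_subgroup V -> matrix_honda V.
Proof. by move=> VG; apply: (@finite_matrix_honda _ _ _ (enum F)) => // g _ i j;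
  rewrite mem_enum. Qed.

(** Equivalently, [K] is algebraic over its prime field with [p] elements. *)
Definition locally_finite_field (K : fieldType) (p : nat) : Prop :=
  p \in [pchar K] /\ forall x : K, exists2 r, (0 < r)%N & x ^+ (p ^ r) = x.

(** Roots are split off one at a time. Applied to ['X^(p ^ r) - 'X], this lists the elements fixed
    by a power of the Frobenius. *)
Lemma poly_root_seq (K : fieldType) (P : {poly K}) :
  P != 0 -> exists s : seq K, forall z, root P z -> z \in s.
Proof.
have [m] := ubnP (size P); elim: m P => // m IH P lt_P nzP.
have [[z Pz] | noroot] := classic (exists z, root P z); last first.
  by exists [::] => z Pz; case: noroot; exists z.
have [Q DP] := factor_theorem P z Pz.
have nzQ : Q != 0 by apply: contraNneq nzP => Q0; rewrite DP Q0 mul0r.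
have [|s sP] := IH Q _ nzQ.
  by move: lt_P; rewrite DP size_Mmonic ?monicXsubC // size_XsubC addn2.
exists (z :: s) => w; rewrite DP rootM root_XsubC inE orbC => /orP[-> //|/sP->].
by rewrite orbT.
Qed.

(** A power [phi] of the Frobenius fixes all entries of [a], [b], [x], [y]. The elements of [V]
    fixed by [phi] form a subgroup whose entries lie in a finite list. *)
Lemma locally_finite_honda (K : fieldType) p n (V : pred 'M[K]_n) :
  locally_finite_field K p -> matrix_subgroup V -> matrix_honda V.
Proof.
move=> [pK finK] [V1 VM VV] s t i j a b x y Va Vb Vx Vy Dx Dy Dx'.
have p_pr : prime p by case/andP: pK.
have fix_mul r m (z : K) : z ^+ (p ^ r) = z -> z ^+ (p ^ (r * m)) = z.
  by move=> Ez; elim: m => [|m IH]; rewrite ?muln0 // mulnS expnD exprM Ez.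
have fix_seq (zs : seq K) : exists2 r, (0 < r)%N & forall z, z \in zs -> z ^+ (p ^ r) = z.
  elim: zs => [|z zs [r r_gt0 IH]]; first by exists 1%N.
  have [r' r'_gt0 Ez] := finK z; exists (r * r')%N; first by rewrite muln_gt0 r_gt0.
  move=> w; rewrite inE => /predU1P[-> | /IH]; last exact: fix_mul.
  by rewrite mulnC; apply: fix_mul.
pose ent (g : 'M[K]_n) := [seq g kl.1 kl.2 | kl : 'I_n * 'I_n].
have [r r_gt0 fixr] := fix_seq (ent a ++ ent b ++ ent x ++ ent y).
have [phi phiE] : exists phi : {rmorphism K -> K}, forall z, phi z = z ^+ (p ^ r).
  elim: (r) => [|m [phi phiE]]; first by exists idfun => z; rewrite expr1.
  exists (pFrobenius_aut pK \o phi) => z /=.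
  by rewrite phiE pFrobenius_autE -exprM expnSr.
have phi_fix g : {subset ent g <= ent a ++ ent b ++ ent x ++ ent y} -> map_mx phi g = g.
  move=> sub; apply/matrixP=> k l; rewrite mxE phiE fixr // sub //.
  by apply/imageP; exists (k, l).
pose V' := [pred g | (g \in V) && (map_mx phi g == g)].
have V'G : matrix_subgroup V'.
  split=> [|g h|g].
  - by rewrite inE /= V1 map_mx1 eqxx.
  - case/andP=> Vg /eqP phig /andP[Vh /eqP phih].
    by rewrite inE /= VM // map_mxM /= phig phih eqxx.
  case/andP=> Vg /eqP phig; have [Ug VgV] := VV g Vg; split=> //.
  by rewrite inE /= VgV map_invmx phig eqxx.
have inV' g : g \in V -> {subset ent g <= ent a ++ ent b ++ ent x ++ ent y} -> g \in V'.
  by move=> Vg /phi_fix phig; rewrite inE /= Vg phig eqxx.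
have q_gt1 : (1 < p ^ r)%N by rewrite -(exp1n r) ltn_exp2r ?prime_gt1.
have [|rs rsP] := @poly_root_seq K ('X^(p ^ r) - 'X).
  rewrite -size_poly_eq0 size_polyDl ?size_polyXn // size_polyN size_polyX.
  by rewrite ltnS.
have V'rs g : g \in V' -> forall k l, g k l \in rs.
  case/andP=> _ /eqP/matrixP phig k l; apply: rsP.
  by rewrite rootE !hornerE -phiE -[X in _ - X]phig mxE subrr.
have sub g : g \in [:: a; b; x; y] -> {subset ent g <= ent a ++ ent b ++ ent x ++ ent y}.
  rewrite !inE => /or4P[] /eqP-> w; rewrite !mem_cat => ->; by rewrite ?orbT.
have [||||c [d [/andP[Vc _] /andP[Vd _] E]]] :=
  finite_matrix_honda V'G V'rs _ _ _ _ Dx Dy Dx'; last by exists c, d.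
- by apply: inV' => //; apply: sub; rewrite !inE eqxx.
- by apply: inV' => //; apply: sub; rewrite !inE eqxx ?orbT.
- by apply: inV' => //; apply: sub; rewrite !inE eqxx ?orbT.
- by apply: inV' => //; apply: sub; rewrite !inE eqxx ?orbT.
Qed.

(** If [P] is a monic polynomial over the prime field vanishing at [x], then [x ^+ m] depends only
    on ['X^m] modulo [P], which takes finitely many values. Two powers [x ^+ (p ^ u)] and
    [x ^+ (p ^ v)] thus agree, and injectivity of the Frobenius cancels [p ^ u]. *)
Lemma pchar_closure p : prime p -> exists K : fieldType,
  GRing.closed_field_axiom K /\ locally_finite_field K p.
Proof.
move=> p_pr; have [K [phi intK]] := countable_algebraic_closure 'F_p.
exists K; split; first exact: solve_monicpoly.
have pK : p \in [pchar K] by rewrite (fmorph_pchar phi) pchar_Fp.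
split=> // x; have [P monP Px] := intK x.
pose red m : {ffun 'I_(size P) -> 'F_p} := [ffun k => ('X^m %% P)`_(val k : nat)].
have red_val m m' : red m = red m' -> x ^+ m = x ^+ m'.
  move=> Emm'.
  have E : 'X^m %% P = 'X^m' %% P.
    apply/polyP=> k; have [lt_k|le_k] := ltnP k (size P).
      by have /ffunP/(_ (Ordinal lt_k)) := Emm'; rewrite !ffunE.
    have nzP := monic_neq0 monP.
    by rewrite !nth_default // (leq_trans _ le_k) // ltnW ?ltn_modp.
  have valE k : x ^+ k = (map_poly phi ('X^k %% P)).[x].
    have := congr1 (fun Q => (map_poly phi Q).[x]) (divp_eq 'X^k P).
    rewrite /= rmorphD rmorphM /= hornerD hornerM (eqP Px) mulr0 add0r => <-.
    by rewrite map_polyXn hornerXn.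
  by rewrite !valE E.
have /injectivePn[u [v neq_uv Euv]] :
    ~~ injectiveb (fun u : 'I_(#|{ffun 'I_(size P) -> 'F_p}|).+1 => red (p ^ u)%N).
  by apply/negP=> /injectiveP/leq_card; rewrite card_ord ltnn.
wlog lt_uv : u v neq_uv Euv / (u < v)%N => [IH|].
  case: (ltngtP u v) => [||Duv]; [exact: IH | |by rewrite (val_inj Duv) eqxx in neq_uv].
  by apply: IH; rewrite // eq_sym.
exists (v - u)%N; first by rewrite subn_gt0.
have frobI m : injective (fun z : K => z ^+ (p ^ m)).
  elim: m => [|m IH] w z; first by rewrite expn0 !expr1.
  rewrite expnSr !exprM -!(pFrobenius_autE pK) => /fmorph_inj; exact: IH.
by apply: (frobI u); rewrite -exprM -expnD subnK 1?ltnW // (red_val _ _ Euv).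
Qed.

(** In characteristic [p] an algebraic closure of the prime field will do. In characteristic 0 a
    prime above [N] is used: it divides no positive integer below [N]. *)
Lemma char_field_sample (k : fieldType) N : exists K : fieldType,
  [/\ GRing.closed_field_axiom K, exists p,
    locally_finite_field K p & same_small_char N K k].
Proof.
have [[p pk] | nchar] := classic (exists p, p \in [pchar k]).
  have p_pr : prime p by case/andP: pk.
  have [K [clK lfK]] := pchar_closure p_pr; exists K; split=> //; first by exists p.
  by move=> m _; rewrite -(dvdn_pcharf pk) -(dvdn_pcharf lfK.1).
have [p lt_Np p_pr] := prime_above N.
have [K [clK lfK]] := pchar_closure p_pr; exists K; split=> //; first by exists p.
have /pcharf0P k0 : [pchar k] =i pred0.
  by move=> q; apply/negP=> qk; case: nchar; exists q.
move=> m lt_mN; rewrite k0 -(dvdn_pcharf lfK.1).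
case: m lt_mN => [|m] lt_mN; first by rewrite dvdn0.
by rewrite gtnNdvd // (ltn_trans lt_mN).
Qed.

Lemma field_honda (k : fieldType) n (E : seq {mpoly k[n * n + 1]}) :
  GRing.closed_field_axiom k \/ pseudo_finite k ->
  matrix_subgroup (closed_points E (idfun : {rmorphism k -> k})) ->
  matrix_honda (closed_points E (idfun : {rmorphism k -> k})).
Proof.
have [labels [e lt_e <-]] := gen_polys E => kP VG s t i j.
have [f [rf fH Hf]] := honda_sentence lt_e s t i j.
apply: Hf => //; case: kP => [clk | [_ pfk]].
  have [N NP] := closed_field_transfer rf.
  have [K [clK [p lfK] Kk]] := char_field_sample k N.
  apply: NP Kk _ => //; apply: fH => V HV.
  exact: (locally_finite_honda lfK).
apply: pfk => // F e'; apply: fH => V HV.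
exact: finite_field_honda.
Qed.

(** * Compactness of valuation rings of local fields *)

(** Otherwise each value has a bound beyond which it is not taken on [S], and an index in [S] past
    all the bounds has no possible value. *)
Lemma infinite_pigeonhole (T : finType) (S : nat -> Prop) (f : nat -> T) :
  (forall m, exists2 i, (m <= i)%N & S i) ->
  exists t, forall m, exists2 i, (m <= i)%N & S i /\ f i = t.
Proof.
move=> infS; apply: NNPP => noT.
have /fin_all_exists[b bP] : forall t, exists m, forall i, (m <= i)%N -> S i -> f i <> t.
  move=> t; apply: NNPP => H; apply: noT; exists t => m; apply: NNPP => H'.
  by apply: H; exists m => i le_mi Si fi; apply: H'; exists i.
have [i le_i Si] := infS (\max_t b t).
by apply: (bP (f i) i) => //; apply: leq_trans le_i; apply: leq_bigmax.
Qed.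

(** * Valuations and sequential compactness *)

Section Valuation.
Variables (K : fieldType) (v : K -> int).
Hypothesis vP : is_valuation v.

Lemma val_ge0 N : val_ge v N 0. Proof. by rewrite /val_ge eqxx. Qed.

Lemma val_geE N x : x != 0 -> val_ge v N x = (N <= v x).
Proof. by rewrite /val_ge => /negPf->. Qed.

Lemma valuationM x y : x != 0 -> y != 0 -> v (x * y) = v x + v y.
Proof. exact: vP.1. Qed.

Lemma valuation1 : v 1 = 0.
Proof. by apply: (addrI (v 1)); rewrite addr0 -valuationM ?oner_eq0 // mulr1. Qed.

Lemma valuationV x : x != 0 -> v x^-1 = - v x.
Proof. by move=> nzx; apply: (addrI (v x));
  rewrite -valuationM ?invr_eq0 // mulfV // valuation1 subrr. Qed.

Lemma valuationX x m : x != 0 -> v (x ^+ m) = v x *+ m.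
Proof. by move=> nzx; elim: m => [|m IH];
  rewrite ?valuation1 // exprS valuationM ?expf_neq0 // IH mulrS. Qed.

Lemma valuationN1 : v (-1) = 0.
Proof.
have N1 : (-1 : K) != 0 by rewrite oppr_eq0 oner_eq0.
by have := valuationM N1 N1; rewrite mulrNN mulr1 valuation1; lia.
Qed.

Lemma val_ge_le M N x : M <= N -> val_ge v N x -> val_ge v M x.
Proof. by rewrite /val_ge => le_MN /orP[-> // | /(le_trans le_MN) ->]; rewrite orbT. Qed.

Lemma val_geD N x y : val_ge v N x -> val_ge v N y -> val_ge v N (x + y).
Proof. exact: vP.2. Qed.

Lemma val_geM M N x y : val_ge v M x -> val_ge v N y -> val_ge v (M + N) (x * y).
Proof.
have [-> | nzx] := eqVneq x 0; first by rewrite mul0r !val_ge0.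
have [-> | nzy] := eqVneq y 0; first by rewrite mulr0 !val_ge0.
by rewrite !val_geE ?mulf_neq0 // valuationM // => le1 le2; apply: lerD.
Qed.

Lemma val_geN N x : val_ge v N x -> val_ge v N (- x).
Proof.
have: val_ge v 0 (-1) by rewrite /val_ge valuationN1 lexx orbT.
by move=> v1 vx; rewrite -mulN1r -[N]add0r val_geM.
Qed.

Lemma val_geB N x y : val_ge v N x -> val_ge v N y -> val_ge v N (x - y).
Proof. by move=> vx vy; rewrite val_geD ?val_geN. Qed.

Lemma val_ge_sum N I (r : seq I) (P : pred I) (F : I -> K) :
  (forall i, P i -> val_ge v N (F i)) -> val_ge v N (\sum_(i <- r | P i) F i).
Proof.
by move=> FP; elim/big_ind: _ => //; [exact: val_ge0 | move=> *; apply: val_geD].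
Qed.

Lemma val_ge_inf x : (forall N : nat, val_ge v N%:Z x) -> x = 0.
Proof.
move=> vx; apply/eqP; apply: contraT => nzx.
by have := vx `|v x|.+1%N; rewrite val_geE //; lia.
Qed.

Lemma val_ge_mulV N x y : x != 0 -> v x = N -> val_ge v N y -> val_ge v 0 (x^-1 * y).
Proof.
move=> nzx vx vy; rewrite -(addNr N); apply: val_geM => //.
by rewrite /val_ge valuationV // vx lexx orbT.
Qed.

(** Finiteness of the valuation ring modulo each [{v >= N}]. The representatives are allowed to lie
    anywhere in [K]. *)
Definition finite_residues : Prop := forall N : nat, exists r : seq K,
  forall x, val_ge v 0 x -> has (fun y => val_ge v N%:Z (x - y)) r.

Hypotheses (vfin : finite_residues) (vcomplete : val_complete v).

(** A diagonal argument: nested infinite sets [S N] of indices are chosen so that the terms indexed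
    by [S N] agree to precision [N]; picking [ix N] in [S N] beyond [N] gives a Cauchy
    subsequence. *)
Lemma val_bolzano_weierstrass m n (u : nat -> 'M[K]_(m, n)) :
    (forall i k l, val_ge v 0 (u i k l)) ->
  exists2 w : 'M[K]_(m, n), forall k l, val_ge v 0 (w k l) &
    forall N : nat, exists2 i, (N <= i)%N & forall k l, val_ge v N%:Z (u i k l - w k l).
Proof.
move=> uO; pose infinite (S : nat -> Prop) := forall m, exists2 i, (m <= i)%N & S i.
pose same N i j := forall k l, val_ge v N%:Z (u i k l - u j k l).
have step (S : {S | infinite S}) (N : nat) : exists S' : {S' | infinite S'},
    (forall i, sval S' i -> sval S i) /\ forall i j, sval S' i -> sval S' j -> same N i j.
  case: S => S infS /=; have [r rP] := vfin N.
  pose T := {ffun 'I_m * 'I_n -> 'I_(size r).+1}.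
  pose f i : T := [ffun kl => inord (find (fun y =>
    val_ge v N%:Z (u i kl.1 kl.2 - y)) r)].
  have [t tP] := infinite_pigeonhole f infS.
  exists (exist _ (fun i => S i /\ f i = t) tP);
    split=> [i []//|i j /= [_ fi] [_ fj] k l].
  have /ffunP/(_ (k, l)) : f i = f j by rewrite fi fj.
  rewrite !ffunE /= => /(congr1 val); rewrite /= !inordK ?ltnS ?find_size // => Eij.
  have := nth_find 0 (rP _ (uO i k l)); have := nth_find 0 (rP _ (uO j k l)).
  rewrite Eij; set z := nth 0 r _ => vj vi.
  by rewrite -(subrKA z) val_geD ?vi // -opprB val_geN ?vj.
pose next S N := proj1_sig (constructive_indefinite_description _ (step S N)).
have nextP S N := proj2_sig (constructive_indefinite_description _ (step S N)).
have inf0 : infinite (fun=> True) by move=> i; exists i.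
pose fix S N : {S | infinite S} :=
  if N is N'.+1 then next (S N') N else next (exist _ _ inf0) 0%N.
have S_same N i j : sval (S N) i -> sval (S N) j -> same N i j.
  by case: N => [|N]; apply: (nextP _ _).2.
have S_sub N N' i : (N <= N')%N -> sval (S N') i -> sval (S N) i.
  move/subnK <-; elim: (N' - N)%N => // d IH /= /(nextP _ _).1; exact: IH.
have /choice[ix ixP] : forall N, exists i, (N <= i)%N /\ sval (S N) i.
  by move=> N; have [i] := proj2_sig (S N) N; exists i.
have ix_same N N' : (N <= N')%N -> same N (ix N) (ix N').
  move=> le_NN'; apply: S_same; first exact: (ixP N).2.
  exact: S_sub le_NN' (ixP N').2.
have lim (kl : 'I_m * 'I_n) : exists w, forall N : nat, exists N',
    (N <= N')%N /\ val_ge v N%:Z (u (ix N') kl.1 kl.2 - w).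
  have [|w wP] := vcomplete (u := fun N => u (ix N) kl.1 kl.2).
    move=> N; exists `|N|%N => i j le_i le_j.
    apply: (@val_ge_le _ `|N|%:Z); first by lia.
    rewrite -(subrKA (u (ix `|N|%N) kl.1 kl.2)) val_geD ?ix_same // -opprB.
    by rewrite val_geN ?ix_same.
  exists w => N; have [m0 m0P] := wP N%:Z.
  by exists (maxn N m0); rewrite leq_maxl m0P ?leq_maxr.
have {lim} /fin_all_exists[w wP] := lim.
have wP' N k l : val_ge v N%:Z (u (ix N) k l - w (k, l)).
  have [N' [le_N vN']] := wP (k, l) N.
  by rewrite -(subrKA (u (ix N') k l)) val_geD ?ix_same.
exists (\matrix_(k, l) w (k, l)) => [k l | N].
  rewrite mxE -[w _](subKr (u (ix 0%N) k l)) val_geB //; exact: wP' 0%N k l.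
by exists (ix N) => [|k l]; [exact: (ixP N).1 | rewrite mxE].
Qed.
End Valuation.

(** * The Honda property over compact valuation rings *)

Section CompactRing.
Variables (O : comUnitRingType) (K : fieldType) (v : K -> int) (iota : {rmorphism O ->
  K}).
Hypotheses (vP : is_valuation v) (vfin : finite_residues v) (vcomplete : val_complete v).
Hypotheses (iota_inj : injective iota)
  (iotaP : forall x, (exists a, iota a = x) <-> val_ge v 0 x).

Let I (N : nat) : pred O := fun x => val_ge v N%:Z (iota x).
Let cong N x y := I N (x - y).

Let vO x : val_ge v 0 (iota x). Proof. by apply/iotaP; exists x. Qed.
Let I0 N : I N 0. Proof. by rewrite /I rmorph0 val_ge0. Qed.
Let ID N x y : I N x -> I N y -> I N (x + y).
Proof. by rewrite /I rmorphD; apply: val_geD. Qed.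
Let IN N x : I N x -> I N (- x). Proof. by rewrite /I rmorphN; apply: val_geN. Qed.
Let IB N x y : I N x -> I N y -> I N (x - y).
Proof. by rewrite /I rmorphB; apply: val_geB. Qed.
Let IM N x y : I N x -> I N (x * y).
Proof. by rewrite /I rmorphM => Ix; rewrite -[N%:Z]addr0 val_geM. Qed.
Let I_le N N' x : (N <= N')%N -> I N' x -> I N x.
Proof. by move=> le_N; apply: val_ge_le. Qed.
Let I_inf x : (forall N, I N x) -> x = 0.
Proof. by move=> Ix; apply: iota_inj; rewrite rmorph0; apply: val_ge_inf Ix. Qed.

Let cong_refl N x : cong N x x. Proof. by rewrite /cong subrr. Qed.
Let cong_sym N x y : cong N x y -> cong N y x.
Proof. by rewrite /cong -[y - x]opprB; apply: IN. Qed.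
Let cong_trans N x y z : cong N x y -> cong N y z -> cong N x z.
Proof. by rewrite /cong -[x - z](subrKA y); apply: ID. Qed.
Let congD N x y x' y' : cong N x x' -> cong N y y' -> cong N (x + y) (x' + y').
Proof. by rewrite /cong opprD addrACA; apply: ID. Qed.
Let congM N x y x' y' : cong N x x' -> cong N y y' -> cong N (x * y) (x' * y').
Proof.
move=> cx cy; apply: (@cong_trans _ _ (x' * y)); first by rewrite /cong -mulrBl;
  apply: IM.
by rewrite /cong -mulrBr mulrC; apply: IM.
Qed.
Let congX N x x' m : cong N x x' -> cong N (x ^+ m) (x' ^+ m).
Proof. by move=> cx; elim: m => [|m IH]; rewrite ?expr0 // !exprS; apply: congM. Qed.
Let cong_sum N (J : Type) (r : seq J) (F G : J -> O) :
  (forall j, cong N (F j) (G j)) -> cong N (\sum_(j <- r) F j) (\sum_(j <- r) G j).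
Proof. by move=> FG; apply: (big_ind2 (cong N)) => // *; exact: congD. Qed.
Let cong_prod N (J : Type) (r : seq J) (F G : J -> O) :
  (forall j, cong N (F j) (G j)) -> cong N (\prod_(j <- r) F j) (\prod_(j <- r) G j).
Proof. by move=> FG; apply: (big_ind2 (cong N)) => // *; exact: congM. Qed.
Let congV N x y : x \is a GRing.unit -> y \is a GRing.unit -> cong N x y ->
  cong N x^-1 y^-1.
Proof.
move=> Ux Uy cxy; have -> // : cong N x^-1 y^-1 = I N ((y - x) * (x^-1 * y^-1)).
  rewrite /cong; congr (I N _).
  by rewrite mulrBl [y * _]mulrCA mulrV // mulr1 mulrA mulrV // mul1r.
by apply: IM; apply: cong_sym.
Qed.

(** A unit lies outside the ideal [I 1], hence so does [y]. Then [iota y] has valuation 0, and its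
    inverse in [K] comes from [O]. *)
Let cong_unit x y : x \is a GRing.unit -> cong 1 x y -> y \is a GRing.unit.
Proof.
move=> Ux cxy; have nI1x : ~~ I 1 x.
  apply/negP=> /(@IM _ _ x^-1); rewrite mulrV // /I rmorph1.
  by rewrite val_geE ?rmorph1 ?oner_eq0 // (valuation1 vP).
have nI1y : ~~ I 1 y by apply: contra nI1x => Iy; rewrite -(subrK y x) ID.
have [nzy vy] : iota y != 0 /\ v (iota y) = 0.
  by move: nI1y (vO y); rewrite /I /val_ge; case: eqP => //= _ ? ?; split=> //; lia.
have [z Ez] : exists z, iota z = (iota y)^-1.
  by apply/iotaP; rewrite /val_ge (valuationV vP) // vy oppr0 lexx orbT.
apply/unitrPr; exists z; apply: iota_inj.
by rewrite rmorphM Ez mulfV // rmorph1.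
Qed.

Section Points.
Variables (n : nat) (E : seq {mpoly O[n * n + 1]}).
Let V := closed_points E (idfun : {rmorphism O -> O}).

Let mxcong m n' N (g h : 'M[O]_(m, n')) := forall k l, cong N (g k l) (h k l).

Let cong_det N (g h : 'M[O]_n) : mxcong N g h -> cong N (\det g) (\det h).
Proof.
move=> cgh; apply: cong_sum => s; apply: congM => //.
by apply: cong_prod => k; apply: cgh.
Qed.

Let cong_coord N (g h : 'M[O]_n) : g \in unitmx -> h \in unitmx -> mxcong N g h ->
  forall k, cong N (GL_coord g k) (GL_coord h k).
Proof.
move=> Ug Uh cgh k; rewrite /GL_coord; case: (split_ordP k) => k' ->.
  by rewrite !row_mxEl; case/mxvec_indexP: k' => i j; rewrite !mxvecE.
by rewrite !row_mxEr ord1 !mxE eqxx !mulr1n; apply: congV;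
  rewrite -?unitmxE ?cong_det //; apply: cong_det.
Qed.

(** The determinant of [c] is congruent to a unit modulo [I 1], so it is a unit; the equations take
    values at [c] that lie in every [I N], so these values are 0. *)
Let closed_limit (c : 'M[O]_n) :
  (forall N, exists2 g, g \in V & mxcong N g c) -> c \in V.
Proof.
move=> lim; have Uc : c \in unitmx.
  have [g /andP[Ug _] cg] := lim 1%N.
  by rewrite unitmxE; apply: (@cong_unit (\det g)); [rewrite -unitmxE | apply: cong_det].
apply/andP; split=> //; apply/allP=> p pE; apply/eqP/I_inf => N.
have [g /andP[Ug /allP/(_ _ pE)/eqP g0] cg] := lim N.
rewrite -[mmap _ _ _]subr0 -g0; apply: cong_sum => m; apply: congM => //.
by apply: cong_prod => k; apply: congX; apply: cong_sym; apply: cong_coord.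
Qed.

(** Only representatives in the image of [iota] are kept; one that is close to an integral element
    is integral itself. *)
Let residues_O N : exists r : seq O, forall x, has (fun z => I N (x - z)) r.
Proof.
have [r rP] := vfin N.
have [r' r'P] : exists r' : seq O, forall a, iota a \in r -> a \in r'.
  elim: (r) => [|z s [r' r'P]]; first by exists [::].
  have [[a Ea] | noa] := classic (exists a, iota a = z).
    exists (a :: r') => b; rewrite !inE => /orP[/eqP Eb | /r'P ->]; last by rewrite orbT.
    by rewrite (iota_inj (etrans Eb (esym Ea))) eqxx.
  exists r' => b; rewrite inE => /orP[/eqP Eb | /r'P //].
  by case: noa; exists b.
exists r' => x; have /hasP[y ry xy] := rP _ (vO x).
have /iotaP[b Eb] : val_ge v 0 y.
  by rewrite -(subKr (iota x) y) val_geB // (val_ge_le _ xy).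
by apply/hasP; exists b; [apply: r'P; rewrite Eb | rewrite /I rmorphB Eb].
Qed.

Lemma compact_ring_honda : matrix_subgroup V -> matrix_honda V.
Proof.
move=> VG s t i j a b x y Va Vb Vx Vy Dx Dy Dx'.
have /choice[cd cdP] : forall N, exists cd : 'M[O]_n * 'M[O]_n,
    [/\ cd.1 \in V, cd.2 \in V & mxcong N (cd.2 * cd.1 * y) (cd.1 * cd.2)].
  move=> N; have [r rP] := residues_O N.
  have [||||c [d [Vc Vd E']]] := @matrix_honda_mod O n V (I N) r s t i j a b x y VG
    _ _ _ _ Va Vb Vx Vy Dx Dy Dx' => //; first exact: IB; first exact: IM.
  by exists (c, d).
(* Placing [c] and [d] side by side makes a single subsequence converge for both. *)
pose u N : 'M[K]_(n, n + n) := map_mx iota (row_mx (cd N).1 (cd N).2).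
have [|w wO wP] := val_bolzano_weierstrass vP vfin vcomplete (u := u).
  by move=> N k l; rewrite mxE.
have /fin_all_exists[w' w'P] : forall kl :
  'I_n * 'I_(n + n), exists z, iota z = w kl.1 kl.2.
  by move=> kl; apply/iotaP.
pose c : 'M[O]_n := \matrix_(k, l) w' (k, lshift n l).
pose d : 'M[O]_n := \matrix_(k, l) w' (k, rshift n l).
have lim N : exists2 M, (N <= M)%N & mxcong N (cd M).1 c /\ mxcong N (cd M).2 d.
  have [M le_NM uw] := wP N; exists M => //; split=> k l.
    by have := uw k (lshift n l); rewrite /u mxE row_mxEl /cong /I rmorphB [c _ _]mxE w'P.
  by have := uw k (rshift n l); rewrite /u mxE row_mxEr /cong /I rmorphB [d _ _]mxE w'P.
exists c, d; split.
- by apply: closed_limit => N; have [M _ [cM _]] := lim N; exists (cd M).1; case: (cdP M).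
- by apply: closed_limit => N; have [M _ [_ dM]] := lim N; exists (cd M).2; case: (cdP M).
apply/matrixP=> k l; apply/eqP; rewrite -subr_eq0; apply/eqP/I_inf => N.
have [M le_NM [cM dM]] := lim N; have [_ _ /(_ k l)/(I_le le_NM) cdM] := cdP M.
have mxcongM (g h g' h' : 'M[O]_n) : mxcong N g g' -> mxcong N h h' ->
  mxcong N (g * h) (g' * h').
  by move=> cg ch k' l'; rewrite !mxE; apply: cong_sum => z; apply: congM.
have cong1 : mxcong N ((cd M).2 * (cd M).1 * y) (d * c * y).
  by apply: (mxcongM); [exact: (mxcongM) | move=> ? ?; exact: cong_refl].
have cong2 : mxcong N ((cd M).1 * (cd M).2) (c * d) by apply: (mxcongM).
exact: cong_trans (cong_sym (cong1 k l)) (cong_trans cdM (cong2 k l)).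
Qed.
End Points.
End CompactRing.

(** * Laurent series fields *)

Section Laurent.
Variables (F : finFieldType) (K : fieldType) (coef : K -> int -> F) (v : K -> int).
Hypothesis coefP : is_laurent_series_field coef.
Hypothesis v_coef : forall x, x != 0 -> coef x (v x) != 0 /\ forall i, i < v x ->
  coef x i = 0.

Let coefD x y i : coef (x + y) i = coef x i + coef y i. Proof. by case: coefP. Qed.
Let coef0 i : coef 0 i = 0.
Proof. by apply: (addrI (coef 0 i)); rewrite -coefD !addr0. Qed.
Let coefB x y i : coef (x - y) i = coef x i - coef y i.
Proof. by apply: (addIr (coef y i)); rewrite -coefD !subrK. Qed.

Let val_geP N x : reflect (forall i, i < N -> coef x i = 0) (val_ge v N x).
Proof.
rewrite /val_ge; have [-> | nzx] /= := eqVneq x 0.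
  by apply: ReflectT => i _; apply: coef0.
have [cvx cx0] := v_coef nzx; apply: (iffP idP) => [le_N i lt_iN | x0].
  by apply: cx0; apply: lt_le_trans le_N.
by rewrite leNgt; apply: contra cvx => /x0->.
Qed.

(** The coefficient of a product at [v x + v y] is the product of the two leading coefficients,
    which is nonzero. *)
Lemma laurent_is_valuation : is_valuation v.
Proof.
split=> [x y nzx nzy | N x y /val_geP xN /val_geP yN]; last first.
  by apply/val_geP=> i lt_iN; rewrite coefD xN // yN // addr0.
have [[cx x0] [cy y0]] := (v_coef nzx, v_coef nzy).
have nzxy : x * y != 0 by rewrite mulf_neq0.
have [cxy xy0] := v_coef nzxy.
case: coefP => _ _ _ _ /(_ x y _ _ x0 y0)[low /(_ 0%N)].
rewrite big_ord1 subn0 !addr0 => top.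
have nz_top : coef (x * y) (v x + v y) != 0 by rewrite top mulf_neq0.
case: (ltgtP (v (x * y)) (v x + v y)) => // [/low E | /xy0 E].
  by rewrite E eqxx in cxy.
by rewrite E eqxx in nz_top.
Qed.

(** An integral series modulo [T^N] is given by its coefficients of index below [N], for which there
    are finitely many choices. *)
Lemma laurent_finite_residues : finite_residues v.
Proof.
move=> N; case: coefP => _ _ ex_coef _ _.
have /fin_all_exists[f fP] : forall f : {ffun 'I_N -> F}, exists x,
    (forall k : 'I_N, coef x (val k)%:Z = f k) /\ forall i, i < 0 -> coef x i = 0.
  move=> f; have [|x xE] := ex_coef (fun i =>
    if i is Posz m then oapp f 0 (insub m) else 0).
    by exists 0 => -[].
  by exists x; split=> [k | [m|m] //]; rewrite xE ?valK.
exists (codom f) => x /val_geP x0; apply/hasP; exists (f [ffun k => coef x (val k)%:Z]).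
  exact: codom_f.
have [fx fx0] := fP [ffun k : 'I_N => coef x (val k)%:Z].
apply/val_geP=> -[m|m] lt_iN; last by rewrite coefB x0 // fx0 // subrr.
have lt_mN : (m < N)%N by [].
by rewrite coefB (fx (Ordinal lt_mN)) ffunE subrr.
Qed.

(** Each coefficient is eventually constant along a Cauchy sequence; the one of index [i] is read
    off at the term [m0 (i + 1)]. *)
Lemma laurent_complete : val_complete v.
Proof.
move=> u cauchy; case: coefP => _ low ex_coef _ _.
have /choice[m0 m0P] : forall N : int, exists m0, forall a b, (m0 <= a)%N ->
  (m0 <= b)%N ->
    forall i, i < N -> coef (u a) i = coef (u b) i.
  move=> N; have [m0 m0P] := cauchy N; exists m0 => a b le_a le_b i lt_iN.
  have /val_geP/(_ i lt_iN) := m0P a b le_a le_b.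
  by rewrite coefB => /eqP; rewrite subr_eq0 => /eqP.
have stable N i a : i < N -> (m0 N <= a)%N -> coef (u (m0 (i + 1))) i = coef (u a) i.
  move=> lt_iN le_a; pose b := maxn (m0 (i + 1)) a.
  rewrite (m0P (i + 1) _ b) ?leq_maxl ?ltrDl //.
  by rewrite (m0P N a b) // leq_max ?le_a ?orbT.
have [|l lE] := ex_coef (fun i => coef (u (m0 (i + 1))) i).
  (* At negative indices the limit has the coefficients of the single series [u (m0 0)], so its
     support is bounded below. *)
  have [N NP] := low (u (m0 0)); exists (Num.min N 0) => i;
    rewrite lt_min => /andP[lt_iN lt_i0].
  by rewrite (stable 0 i (m0 0)) // NP.
exists l => N; exists (m0 N) => a le_a; apply/val_geP=> i lt_iN.
by rewrite coefB lE (stable N i a) // subrr.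
Qed.
End Laurent.

(** * The p-adic numbers *)

Section Padic.
Variables (p : nat) (Qp : fieldType) (v : Qp -> int).
Hypotheses (p_pr : prime p) (QpP : is_padic_field p v).

Let vP : is_valuation v. Proof. by case: QpP. Qed.

Lemma padic_uniformizer : (p%:R != 0 :> Qp) /\ v p%:R = 1.
Proof.
case: QpP => _ _ [iota [iotaP _]].
have nzp : (p%:R : rat) != 0 by rewrite pnatr_eq0 -lt0n prime_gt0.
rewrite -(rmorph_nat iota) fmorph_eq0 iotaP // /padic_val; split=> //.
by rewrite -[p%:R]/(p%:Z%:~R) numq_int denq_int logn1 subr0 logn_prime ?eqxx.
Qed.

Lemma val_ge_int (z : int) : val_ge v 0 z%:~R.
Proof.
have vnat m : val_ge v 0 m%:R.
  elim: m => [|m IH]; first exact: val_ge0.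
  by rewrite mulrSr val_geD // /val_ge (valuation1 vP) lexx orbT.
case: z => m; first exact: vnat.
by rewrite NegzE rmorphN; apply: val_geN => //; exact: vnat.
Qed.

(** The integers from 0 to [p ^ N - 1] represent all classes: [x] is approximated by a rational [q],
    whose denominator is prime to [p] and so is invertible modulo [p ^ N]. *)
Lemma padic_finite_residues : finite_residues v.
Proof.
move=> N; have [nzp vp1] := padic_uniformizer.
case: QpP => _ _ [iota [iotaP dense]].
exists [seq (m%:R : Qp) | m <- seq.iota 0 (p ^ N)] => x xO.
have [q xq] := dense x N%:Z.
have qO : val_ge v 0 (iota q) by rewrite -(subKr x (iota q)) val_geB // (val_ge_le _ xq).
(* Since [q] is integral, a factor [p] of its denominator would also divide its numerator. *)
have ndvd : ~~ (p %| `|denq q|)%N.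
  have [-> | nzq] := eqVneq q 0; first by rewrite (_ :
    denq 0 = 1) // dvdn1 neq_ltn prime_gt1 ?orbT.
  move: qO; rewrite val_geE ?fmorph_eq0 // iotaP // /padic_val => le_log.
  apply/negP=> p_den; have := coprime_num_den q; move/eqP=> co.
  have log_den : (0 < logn p `|denq q|)%N by rewrite logn_gt0 mem_primes p_pr absz_gt0
    denq_neq0.
  have log_num : (0 < logn p `|numq q|)%N by lia.
  move: log_num; rewrite logn_gt0 mem_primes => /and3P[_ _ p_num].
  have : (p %| gcdn `|numq q| `|denq q|)%N by rewrite dvdn_gcd p_num.
  by rewrite co dvdn1 => /eqP p1; move: p_pr; rewrite p1.
have vden : v (denq q)%:~R = 0.
  have := iotaP (denq q)%:~R; rewrite rmorph_int => ->;
    last by rewrite intr_eq0 denq_neq0.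
  rewrite /padic_val numq_int denq_int logn1 subr0; apply/eqP; rewrite eqz_nat.
  by rewrite lognE (negPf ndvd) !andbF.
have nzden : (denq q)%:~R != 0 :> Qp.
  by rewrite -(rmorph_int iota) fmorph_eq0 intr_eq0 denq_neq0.
have [m [lt_m [z Ez]]] : exists m, (m < p ^ N)%N /\
    exists z : int, numq q - denq q * m%:Z = z * (p ^ N)%N%:Z.
  have co : coprimez (denq q) (p ^ N)%N%:Z.
    by rewrite coprimezE coprime_sym coprimeXl // prime_coprime.
  have [[b c] /= bc] := coprimezP _ _ co.
  have pN_gt0 : (0 < p ^ N)%N by rewrite expn_gt0 prime_gt0.
  (* By the Bezout relation, [b] inverts the denominator modulo [p ^ N], so [M] is the residue of
     [q]. *)
  pose M := (b * numq q %% (p ^ N)%N%:Z)%Z.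
  have M_ge0 : 0 <= M by rewrite modz_ge0 // eqz_nat -lt0n.
  have lt_M : M < (p ^ N)%N%:Z by rewrite ltz_pmod.
  exists `|M|%N; split; first by rewrite -ltz_nat gez0_abs.
  rewrite gez0_abs //.
  exists (c * numq q + denq q * (b * numq q %/ (p ^ N)%N%:Z)%Z).
  have -> : M = b * numq q - (b * numq q %/ (p ^ N)%N%:Z)%Z * (p ^ N)%N%:Z.
    by rewrite {1}(divz_eq (b * numq q) (p ^ N)%N%:Z) addrC addKr.
  rewrite -{1}[numq q]mul1r -bc; ring.
apply/hasP; exists m%:R; first by apply: map_f; rewrite mem_iota.
rewrite -(subrKA (iota q)) val_geD //.
have -> : iota q - m%:R = z%:~R * p%:R ^+ N * (denq q)%:~R^-1.
  apply: (mulIf nzden); rewrite mulfVK // mulrBl -[X in iota X]divq_num_den fmorph_div.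
  rewrite !rmorph_int mulfVK //.
  have -> : z%:~R * p%:R ^+ N = (numq q - denq q * m%:Z)%:~R :> Qp.
    by rewrite Ez rmorphM /= -natrX.
  by rewrite rmorphB rmorphM /= mulrC.
rewrite -[N%:Z]addr0; apply: val_geM => //; last first.
  by rewrite /val_ge (valuationV vP) // vden lexx orbT.
rewrite -[N%:Z]add0r; apply: val_geM => //; first exact: val_ge_int.
by rewrite /val_ge (valuationX vP) // vp1 natz lexx orbT.
Qed.
End Padic.

(** * Finite extensions in coordinates over the base field *)

Section FiniteExtension.
Variables (F : fieldType) (vF : F -> int) (L : fieldExtType F) (v : L -> int) (e : nat).
Hypotheses (vFP : is_valuation vF) (vFfin : finite_residues vF) (vFcomplete :
  val_complete vF).
Hypotheses (vP : is_valuation v) (e_gt0 : (0 < e)%N).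
Hypothesis v_alg : forall x : F, x != 0 -> v x%:A = vF x *+ e.
Variable pi : F.
Hypotheses (nz_pi : pi != 0) (v_pi : vF pi = 1).

Let D := \dim {:L}.
Let b : D.-tuple L := vbasis {:L}.
Let c (x : L) : 'I_D -> F := fun i => coord b i x.
Let comb (w : 'I_D -> F) : L := \sum_i w i *: b`_i.

Let combK x : comb (c x) = x.
Proof. by rewrite [RHS](coord_vbasis (memvf x)). Qed.

Let cK w i : c (comb w) i = w i.
Proof. by rewrite /c /comb coord_sum_free ?(basis_free (vbasisP _)). Qed.

Let cB x y i : c (x - y) i = c x i - c y i. Proof. exact: raddfB. Qed.
Let cZ a x i : c (a *: x) i = a * c x i. Proof. exact: linearZ. Qed.

Let combB w w' : comb w - comb w' = comb (fun i => w i - w' i).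
Proof. by rewrite /comb -sumrB; apply: eq_bigr => i _; rewrite scalerBl. Qed.

Let valZ M N a x : val_ge vF M a -> val_ge v N x -> val_ge v (M *+ e + N) (a *: x).
Proof.
have [-> | nza] := eqVneq a 0; first by rewrite scale0r => _ _; apply: val_ge0.
rewrite (val_geE _ _ nza) => vFa vx; rewrite -mulr_algl val_geM // val_geE ?v_alg //;
  last first.
  by rewrite scaler_eq0 oner_eq0 orbF.
by rewrite lerMn2r vFa orbT.
Qed.

(** The loss [B] is the largest absolute value of the valuation of a basis vector. *)
Let comb_lower : exists B : nat, forall (M : int) w,
  (forall i, val_ge vF M (w i)) -> val_ge v (M *+ e - B%:Z) (comb w).
Proof.
exists (\max_(i < D) `|v b`_i|)%N => M w wM; apply: val_ge_sum => // i _;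
  apply: valZ => //.
have [-> | nzb] := eqVneq b`_i 0; first exact: val_ge0.
rewrite val_geE //; have := @leq_bigmax _ (fun i : 'I_D => `|v b`_i|%N) i.
by move=> /=; move: (\max_(_ < D) _)%N (v _) => m z; lia.
Qed.

(* Dividing x by its coordinate of least valuation makes that coordinate 1. *)
Let normalize x i C : val_ge v 0 x -> ~~ val_ge vF (- C%:Z) (c x i) ->
  exists y j, [/\ val_ge v C%:Z y, forall k, val_ge vF 0 (c y k) & c y j = 1].
Proof.
move=> vx nci; have nzi : c x i != 0 by apply: contraNneq nci => ->; apply: val_ge0.
pose P := [pred k | c x k != 0].
case: (@Order.TotalTheory.arg_minP _ _ _ i P (fun k => vF (c x k)) nzi) => j nzj minj.
have ltj : vF (c x j) <= - C%:Z.
  apply: le_trans (minj i nzi) _; move: nci; rewrite val_geE //; lia.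
exists ((c x j)^-1 *: x), j; split=> [|k|].
- have vj : val_ge vF (- vF (c x j)) (c x j)^-1.
    by rewrite val_geE ?invr_eq0 // (valuationV vFP).
  apply: val_ge_le (valZ vj vx); rewrite addr0; move: ltj e_gt0; move: (vF _) => z; nia.
- rewrite cZ; have [-> | nzk] := eqVneq (c x k) 0; first by rewrite mulr0 val_ge0.
  by apply: val_ge_mulV => //; rewrite val_geE //; apply: minj.
by rewrite cZ mulVf.
Qed.

(* Otherwise normalized vectors with valuation tending to +oo would accumulate
   at a vector with some coordinate 1 and infinite valuation. *)
Let coord_lower : exists C : nat, forall x, val_ge v 0 x ->
  forall i, val_ge vF (- C%:Z) (c x i).
Proof.
apply: NNPP => noC.
have /choice[yj yjP] : forall C : nat, exists yj : L * 'I_D,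
    [/\ val_ge v C%:Z yj.1, forall k, val_ge vF 0 (c yj.1 k) & c yj.1 yj.2 = 1].
  move=> C; apply: NNPP => noy; apply: noC; exists C => x vx i.
  apply: contraT => nci; have [y [j Hy]] := normalize vx nci.
  by case: noy; exists (y, j).
have [|w w0 wP] := val_bolzano_weierstrass vFP vFfin vFcomplete
    (u := fun C => \row_k c (yj C).1 k : 'rV_D).
  by move=> C k l; rewrite mxE; case: (yjP C).
have [B BP] := comb_lower.
(* Both [(yj C).1] and its distance to [comb (w 0)] have valuation at least [N]; precision [N + B]
   on coordinates makes up for the loss in [comb_lower]. *)
have comb0 : comb (w 0) = 0.
  apply: (val_ge_inf (v := v)) => N.
  have [C le_C wC] := wP (N + B)%N; have [vy _ _] := yjP C.
  rewrite -[comb _](subKr (yj C).1) val_geB //.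
    by apply: val_ge_le vy; lia.
  rewrite -[(yj C).1]combK combB; apply: val_ge_le (BP (N + B)%N%:Z _ _); first by nia.
  by move=> k; have := wC 0 k; rewrite mxE.
have w_0 k : w 0 k = 0 by rewrite -[LHS](cK (w 0)) comb0 /c linear0.
have [C _ wC] := wP 1%N; have [_ _ c1] := yjP C.
have := wC 0 (yj C).2; rewrite mxE c1 w_0 subr0 val_geE ?oner_eq0 //.
by rewrite (valuation1 vFP).
Qed.

(** Multiplication by [pi ^+ C] makes the coordinates integral. Approximating them to precision
    [N + B + C] leaves [N + B] after dividing back, and at least [N] after recombination. *)
Lemma extension_finite_residues : finite_residues v.
Proof.
move=> N; have [B BP] := comb_lower; have [C CP] := coord_lower.
have [r rP] := vFfin (N + B + C).
exists [seq comb (fun i => pi ^- C * val (f i)) | f : {ffun 'I_D -> seq_sub r}] => x vx.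
have nz_piC : pi ^+ C != 0 by rewrite expf_neq0.
have v_piC : vF (pi ^+ C) = C%:Z by rewrite (valuationX vFP) // v_pi natz.
have /fin_all_exists[f fP] : forall i, exists z : seq_sub r,
    val_ge vF (N + B + C)%N%:Z (pi ^+ C * c x i - val z).
  move=> i; have /hasP[z rz vz] : has (fun y =>
    val_ge vF (N + B + C)%N%:Z (pi ^+ C * c x i - y)) r.
    apply: rP; rewrite -(subrr C%:Z); apply: val_geM => //; last exact: CP.
    by rewrite val_geE // v_piC.
  by exists (SeqSub rz).
apply/hasP; exists (comb (fun i => pi ^- C * val (finfun f i))); first by apply/imageP;
  exists (finfun f).
rewrite -{1}[x]combK combB; apply: val_ge_le (BP (N + B)%N%:Z _ _); first by nia.
move=> i; rewrite ffunE.
have -> : c x i - pi ^- C * val (f i) = pi ^- C * (pi ^+ C * c x i - val (f i)).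
  by rewrite mulrBr mulKf.
have -> : (N + B)%N%:Z = - C%:Z + (N + B + C)%N%:Z by lia.
by apply: val_geM => //; rewrite val_geE ?invr_eq0 // (valuationV vFP) // v_piC.
Qed.

(** Coordinates of a Cauchy sequence are Cauchy: a difference divisible by [pi ^+ M] has coordinates
    of valuation at least [M - C] by [coord_lower]. Coordinatewise limits are then recombined. *)
Lemma extension_complete : val_complete v.
Proof.
move=> u cauchy; have [B BP] := comb_lower; have [C CP] := coord_lower.
have lim i : exists l, forall N, exists m0, forall a, (m0 <= a)%N ->
  val_ge vF N (c (u a) i - l).
  apply: vFcomplete => N; pose M := (`|N| + C)%N.
  have nz_piM : pi ^+ M != 0 by rewrite expf_neq0.
  have v_piM : vF (pi ^+ M) = M%:Z by rewrite (valuationX vFP) // v_pi natz.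
  have [m0 m0P] := cauchy (M%:Z *+ e); exists m0 => a a' le_a le_a'.
  have vuu : val_ge v 0 (pi ^- M *: (u a - u a')).
    rewrite -(addNr (M%:Z *+ e)) -mulNrn; apply: valZ; last exact: m0P.
    by rewrite val_geE ?invr_eq0 // (valuationV vFP) // v_piM.
  have := CP _ vuu i; rewrite cZ cB => vc.
  have -> : c (u a) i - c (u a') i = pi ^+ M * (pi ^- M * (c (u a) i - c (u a') i)).
    by rewrite mulVKf.
  apply: val_ge_le (val_geM vFP (_ : val_ge vF M%:Z _) vc); first by lia.
  by rewrite val_geE // v_piM.
have /fin_all_exists[l lP] := lim; exists (comb l) => N.
have /fin_all_exists[m0 m0P] : forall i, exists m0, forall a, (m0 <= a)%N ->
    val_ge vF (`|N| + B)%N%:Z (c (u a) i - l i) by move=> i; apply: lP.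
exists (\max_i m0 i) => a le_a.
rewrite -{1}[u a]combK combB; apply: val_ge_le (BP (`|N| + B)%N%:Z _ _); first by nia.
by move=> i; apply: m0P; apply: leq_trans le_a; apply: leq_bigmax.
Qed.
End FiniteExtension.

Lemma local_field_compact (K : fieldType) (v : K -> int) : nonarch_local_field v ->
  [/\ is_valuation v, finite_residues v & val_complete v].
Proof.
case=> {K v} [p Qp vp L v e p_pr QpP vP e_gt0 v_alg | F K coef v coefP v_coef];
  last first.
  split; first exact: laurent_is_valuation coefP v_coef.
    exact: laurent_finite_residues coefP v_coef.
  exact: laurent_complete coefP v_coef.
have vpfin := padic_finite_residues p_pr QpP.
have [nzp vp1] := padic_uniformizer p_pr QpP.
have [vpP vpc _] := QpP.
split; first exact: vP.
  exact: (@extension_finite_residues _ _ _ _ _ vpP vpfin vpc vP e_gt0 v_alg _ nzp vp1).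
exact: (@extension_complete _ _ _ _ _ vpP vpfin vpc vP e_gt0 v_alg _ nzp vp1).
Qed.

(** * From matrix identities to the group of rational points *)

Lemma rational_points_subgroup (k : comUnitRingType) n (G : linear_algebraic_group k n) :
  matrix_subgroup (closed_points G (idfun : {rmorphism k -> k})).
Proof.
have [G1 GM GV] := lag_subgroup G idfun; split=> // g Gg.
by split; [case/andP: Gg | apply: GV].
Qed.

(** Comparing the two cyclic subgroups at their generators writes [x] and [y] as signed powers of
    each other, and commutators become inverse-free matrix identities. *)
Lemma rational_points_honda (k : comUnitRingType) n (G : linear_algebraic_group k n) :
  matrix_honda (closed_points G (idfun : {rmorphism k -> k})) ->
  honda_property (rational_points G).
Proof.
move=> honda x y [a [b Dx]] Exy.
have valM (g h : rational_points G) : rp_val (g * h)%g = rp_val g * rp_val h by [].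
have valX (g : rational_points G) m : rp_val (g ^+ m)%g = rp_val g ^+ m.
  by elim: m => [|m IH]; rewrite ?expg0 ?expr0 // expgS exprS valM IH.
have commE (c d z : rational_points G) :
    z = [~ c, d]%g <-> rp_val d * rp_val c * rp_val z = rp_val c * rp_val d.
  rewrite -!valM; split=> [-> | E].
    by rewrite commgEl conjgE !mulgA mulgK mulgV mul1g.
  apply: (mulgI (d * c)%g); rewrite commgEl conjgE !mulgA mulgK mulgV mul1g.
  exact: val_inj.
have powE (g h : rational_points G) : cyclic_subgroup g h ->
    exists s i, signed_power s i (rp_val g) (rp_val h).
  move=> [i [-> | ->]]; first by exists false, i; apply: valX.
  exists true, i; rewrite /= -valX. exact: mulVmx (rp_unit _).
have self (g : rational_points G) : cyclic_subgroup g g by exists 1%N; left;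
  rewrite expg1.
have [s [i Dy]] := powE _ _ ((Exy y).1 (self y)).
have [t [j Dx']] := powE _ _ ((Exy x).2 (self x)).
have [c [d [Vc Vd Dc]]] := honda s t i j _ _ _ _ (rp_valP a) (rp_valP b) (rp_valP x)
  (rp_valP y) ((commE _ _ _).1 Dx) Dy Dx'.
by exists (RationalPoint Vc), (RationalPoint Vd); apply/commE.
Qed.

Theorem theorem1p2 (k : comUnitRingType) (hk : honda_base_ring k)
    (n : nat) (G : linear_algebraic_group k n) :
  honda_property (rational_points G).
Proof.
apply: rational_points_honda; have := rational_points_subgroup G.
case: hk n G => {k} [k clk | k pfk | O [K [v [iota [Kloc iota_inj iotaP]]]]] n G.
- by apply: field_honda; left.
- by apply: field_honda; right.
have [vP vfin vcomplete] := local_field_compact Kloc.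
exact: (@compact_ring_honda _ _ _ _ vP vfin vcomplete iota_inj iotaP).
Qed.
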